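(* Let $\mu\in(0,\tfrac12]$. A probability measure $\nu$ on $\mathcal{S}^{\mathbb{Z}}$ is invariant for the compass model on $\mathbb{Z}$ with parameter $\mu$ if and only if it is a mixture of the measures $\delta_{\bar s}$, $s\in\mathcal{S}$, i.e. if and only if there is a Borel probability measure $\rho$ on $\mathcal{S}$ such that $\nu=\int_{\mathcal{S}}\delta_{\bar s}\,\rho(ds)$. Equivalently, the set $\mathcal{I}$ of invariant measures is the (weakly closed) convex hull of $\{\delta_{\bar s};\ s\in\mathcal{S}\}$.
   Context: Opinion space: $\mathcal{S}=\mathbb{R}/2\mathbb{Z}$ (a circle of perimeter 2), identified with $(-1,1]$ by unique representatives; ''$x \pmod{\mathcal{S}}$'' denotes the representative of $x$ in $(-1,1]$. The metric is $d(x,y)=\min\{|x-y|,\,2-|x-y|\}$ for $x,y\in(-1,1]$, and $\mathcal{S}$ carries the corresponding circle topology. Compass model on $\mathbb{Z}$ with parameter $\mu\in(0,\tfrac12]$: the graph has vertex set $\mathbb{Z}$ and edges $e_v=\langle v,v+1\rangle$, $v\in\mathbb{Z}$. The state space is $\mathcal{S}^{\mathbb{Z}}$ with the product topology. The edges carry independent Poisson processes of rate 1, independent of the initial configuration $\bm{\eta}_0$. When the Poisson process of an edge $\langle u,v\rangle$ has an event at time $t$, only the opinions at $u$ and $v$ change: let $\delta\in(-1,1]$ be the representative of $\eta_{t-}(v)-\eta_{t-}(u)$. If $\delta\neq 1$, set $\sigma=\delta$; if $\delta=1$ (diametrically opposed opinions), let $\sigma\in\{-1,+1\}$ be chosen uniformly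 at random, independently of everything else. Then $\eta_t(u)=\eta_{t-}(u)+\mu\sigma \pmod{\mathcal{S}}$ and $\eta_t(v)=\eta_{t-}(v)-\mu\sigma\pmod{\mathcal{S}}$. A probability measure $\nu$ on $\mathcal{S}^{\mathbb{Z}}$ is invariant if $\bm{\eta}_0\sim\nu$ implies $\bm{\eta}_t\sim\nu$ for all $t\ge0$. For $s\in\mathcal{S}$, $\bar s\in\mathcal{S}^{\mathbb{Z}}$ is the constant configuration with value $s$ at all vertices, and $\delta_{\bar s}$ is the Dirac measure at $\bar s$. *)

(* Defs.v *)
From HB Require Import structures.
From mathcomp Require Import all_boot all_order all_algebra.
From mathcomp Require Import all_classical all_reals all_analysis.
From mathcomp Require Import ring lra.

Set Implicit Arguments.
Unset Strict Implicit.
Unset Printing Implicit Defensive.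

Import Order.TTheory GRing.Theory Num.Theory.
Import numFieldTopology.Exports numFieldNormedType.Exports.

Local Open Scope classical_set_scope.
Local Open Scope ring_scope.

(** The opinion space R/2Z, each class being given by its representative
    in (-1, 1]. *)

Record opinion (R : realType) := Opinion {
  rep :> R ;
  rep_itv : -1 < rep <= 1
}.

Section opinion_space.
Variable R : realType.

HB.instance Definition _ := [isSub for @rep R].
HB.instance Definition _ := [Choice of opinion R by <:].

(* the class of r modulo 2 *)
Definition modS_rep (r : R) : R := r - 2 * (Num.ceil ((r - 1) / 2))%:~R.

Lemma modS_subproof (r : R) : -1 < modS_rep r <= 1.
Proof.
rewrite /modS_rep; have := ceil_itv ((r - 1) / 2); rewrite intrB.
by set c := (Num.ceil _)%:~R => /andP[? ?]; apply/andP; split; lra.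
Qed.

Definition modS (r : R) : opinion R := Opinion (modS_subproof r).

HB.instance Definition _ := isPointed.Build (opinion R) (modS 0).

Definition circle_dist (x y : opinion R) : R :=
  Num.min `|rep x - rep y| (2 - `|rep x - rep y|).

Let circle_distxx x : circle_dist x x = 0.
Proof.
by rewrite /circle_dist subrr normr0 subr0 min_l.
Qed.

Let circle_dist_positivity x y : circle_dist x y = 0 -> x = y.
Proof.
case: x y => x hx [y hy]; rewrite /circle_dist /= => h.
apply: val_inj => /=; move: hx hy h => /andP[? ?] /andP[? ?].
by rewrite /Order.min; do ?case: ifPn => ?; case: (ger0P (x - y)) => ? ?; lra.
Qed.

Let circle_dist_sym x y : circle_dist x y = circle_dist y x.
Proof. by rewrite /circle_dist distrC. Qed.

Let circle_dist_triangle y x z :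
  circle_dist x z <= circle_dist x y + circle_dist y z.
Proof.
case: x y z => x hx [y hy] [z hz]; rewrite /circle_dist /=.
move: hx hy hz => /andP[? ?] /andP[? ?] /andP[? ?].
case: (ger0P (x - y)) => ?; case: (ger0P (y - z)) => ?;
case: (ger0P (x - z)) => ?; rewrite /Order.min; do 3 (case: ifPn => ?); lra.
Qed.

HB.instance Definition _ := @isMetric.Build R (opinion R) circle_dist
  circle_distxx circle_dist_positivity circle_dist_sym circle_dist_triangle.

Definition config : Type := {ptws int -> opinion R}.
HB.instance Definition _ := Topological.on config.
HB.instance Definition _ := isPointed.Build config (fun=> point).

End opinion_space.

Definition borel (T : ptopologicalType) : Type :=
  g_sigma_algebraType (@open T).
HB.instance Definition _ (T : ptopologicalType) :=
  Measurable.copy (borel T) (g_sigma_algebraType (@open T)).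

Section measures_on_a_topological_space.
Context {R : realType} (T : ptopologicalType).
Notation prob := (probability (borel T) R).

Definition bounded_continuous : Type :=
  {f : T -> R | continuous f /\ bounded_fun f}.

(* Borel probability measures with the topology of weak convergence, the
   coarsest one making every [m |-> \int f dm], f in C_b(T), continuous *)
Definition weak_prob : Type :=
  initial_topology (fun (m : prob) =>
    (fun f : bounded_continuous => \int[m]_x (sval f x))
      : {ptws bounded_continuous -> R}).
HB.instance Definition _ := Topological.on weak_prob.

(* m is only required to be w m0 + (1 - w) m1 on measurable sets: its values
   on the other sets are irrelevant *)
Definition convex_measures (C : set prob) : Prop :=
  forall (m0 m1 m : prob) (w : R), C m0 -> C m1 -> 0 <= w <= 1 ->
    (forall A, measurable A -> m A = (w%:E * m0 A + (1 - w)%:E * m1 A)%E) ->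
    C m.

Definition closed_convex_hull (D : set prob) : set prob :=
  \bigcap_(C in [set C : set prob |
     [/\ D `<=` C, convex_measures C & closed (C : set weak_prob)]]) C.

End measures_on_a_topological_space.

Section independence.
Context d (Omega : measurableType d) (R : realType) (P : probability Omega R).

Definition mutually_independent (I : eqType) (G : I -> set (set Omega)) : Prop :=
  forall (s : seq I) (A : I -> set Omega), uniq s ->
    (forall i, i \in s -> G i (A i)) ->
    P (\bigcap_(i in [set` s]) A i) = (\prod_(i <- s) P (A i))%E.

End independence.

Section compass.
Context {R : realType}.
Implicit Types (x : config R) (e v : int) (n : nat).

(* The edge <e, e + 1> is denoted by e. *)

(* the sigma of an interaction whose opinion difference is delta; the fair
   coin b is used only between diametrically opposed opinions *)
Definition direction (delta : opinion R) (b : bool) : R :=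
  if rep delta == 1 then (if b then 1 else -1) else rep delta.

(* y is an evolution (for times t >= 0) started from x, when the edge e has its
   events at the times ring e 0, ring e 1, ... and coin e n breaks a possible
   tie at time ring e n. The opinion at v is constant between the events of the
   two edges v - 1 and v at v; hence the value before a jump, eta_{t-}, is the
   common value at all times r < t close to t. *)
Record trajectory (mu : R) (ring : int -> nat -> R) (coin : int -> nat -> bool)
    (x : config R) (y : R -> config R) : Prop := {
  trajectory_start : y 0 = x ;
  trajectory_rest : forall v (r t : R), 0 <= r <= t ->
    (forall n, ~~ (r < ring (v - 1) n <= t) && ~~ (r < ring v n <= t)) ->
    y t v = y r v ;
  trajectory_jump : forall e n, \forall r \near (ring e n)^'-,
    let sigma := direction (modS (rep (y r (e + 1)) - rep (y r e))) (coin e n) in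
    y (ring e n) e = modS (rep (y r e) + mu * sigma) /\
    y (ring e n) (e + 1) = modS (rep (y r (e + 1)) - mu * sigma)
}.

(* Each edge e carries a rate 1 Poisson process, given by its i.i.d. standard
   exponential waiting times tau e 0, tau e 1, ...; together with the coins,
   all these variables are mutually independent. *)
Section graphical_construction.
Context d (Omega : measurableType d) (P : probability Omega R).
Variables (tau : int -> nat -> {RV P >-> R}).
Variables (xi : int -> nat -> {RV P >-> bool}).

Definition noise_events (i : (int * nat) + (int * nat)) : set (set Omega) :=
  match i with
  | inl (e, n) => preimage_set_system setT (tau e n) measurable
  | inr (e, n) => preimage_set_system setT (xi e n) measurable
  end.

Record graphical_noise : Prop := {
  noise_exponential : forall e n A, measurable A ->
    distribution P (tau e n) A = exponential_prob 1 A ;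
  noise_fair : forall e n A, measurable A ->
    distribution P (xi e n) A = bernoulli_prob (1 / 2) A ;
  noise_independent : mutually_independent P noise_events
}.

Definition ring_time (omega : Omega) e n : R :=
  \sum_(k < n.+1) tau e k omega.

(* The compass model driven by (tau, xi): eta t (x, omega) is the configuration
   at time t >= 0 when the initial configuration is x. Under nu \x P, the first
   component is an initial configuration of law nu independent of (tau, xi). *)
Definition compass_flow (mu : R)
    (eta : R -> {mfun (borel (config R) * Omega)%type >-> borel (config R)}) :=
  forall x, {ae P, forall omega,
    trajectory mu (ring_time omega) (fun e n => xi e n omega) x
      (fun t => eta t (x, omega))}.

Definition invariant_measure
    (eta : R -> {mfun (borel (config R) * Omega)%type >-> borel (config R)})
    (nu : probability (borel (config R)) R) : Prop :=
  forall t : R, 0 <= t -> forall A, measurable A ->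
    distribution (nu \x P)%E (eta t) A = nu A.

End graphical_construction.

Definition consensus (s : opinion R) : config R := fun=> s.

Definition consensus_dirac (s : opinion R) : probability (borel (config R)) R :=
  \d_(consensus s : borel (config R)).

Definition consensus_mixture (rho : probability (borel (opinion R)) R)
    (nu : probability (borel (config R)) R) : Prop :=
  forall A, measurable A -> nu A = (\int[rho]_s consensus_dirac s A)%E.

End compass.

(* Main.v *)
Require Import Defs.
From HB Require Import structures.
From mathcomp Require Import all_boot all_order all_algebra.
From mathcomp Require Import all_classical all_reals all_analysis.
From mathcomp Require Import measurable_realfun.
From mathcomp Require Import ring lra zify.

Set Implicit Arguments.
Unset Strict Implicit.
Unset Printing Implicit Defensive.

Import Order.TTheory GRing.Theory Num.Theory.
Import numFieldTopology.Exports numFieldNormedType.Exports.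

Local Open Scope classical_set_scope.
Local Open Scope ring_scope.

(** Write [gap e x] for the circle distance between the opinions at the ends of
    the edge [e]. When [e] rings, its gap is multiplied by [1 - 2 mu] and each
    neighbouring gap grows by at most [mu * gap e x]. In a stationary state the
    mean gaps therefore form a bounded convex function on Z, that is a constant
    [c], and the growth bound is almost surely an equality: the interaction acts
    on the gaps linearly. If a finite linear combination of gaps with
    coefficients [w] is almost surely at most [1], then so is the combination
    obtained by replacing [w] at one edge [e] by
    [w + mu * (discrete Laplacian of w)], because [e] rings alone in a finite
    window with positive probability. Starting from a single gap one produces in
    this way coefficients close to a tent of arbitrarily large total mass [m],
    while [c * m <= 1]. Hence [c = 0]: stationary configurations are constant. *)

(** * The circle *)

(** The dynamics enters only through trajectories, and all that invariance supplies is one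
    inequality for functions [f] of finitely many opinions with values in [0, 1]: up to time [t] the
    edges of a finite window ring at most once in total, outside an event of probability O(t^2),
    where [f] is bounded by 1. As [t] tends to 0 this bounds the mean of [f] by its means after one
    interaction; at [t = 1] it carries [f = 1] almost surely through an interaction. For the gaps
    the first bound is opposite to the growth bound, so the two meet once the mean gap is constant.
    No explicit order of edges drives the weights to their limit. With weight 1 fixed at edge 0 and
    weight 0 at edge M + 1, the mass is pushed to its supremum over all admissible weights: near it
    no step gains much, so the discrete Laplacian is almost nonpositive and the mass is almost at
    least M / 2, that of the linear ramp. Conversely, every vertex almost surely lies between two
    edges silent up to time [t], so a consensus can be followed inside a finite block. *)

Section circle.
Context {R : realType}.
Implicit Types (r : R) (x y : opinion R) (n : int).

(** The distance from [r] to the lattice 2Z. As a quotient norm on all reals it allows estimates on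
    arbitrary lifts, without choosing representatives. *)
Definition cnorm r : R := `|rep (modS r)|.

Lemma rep_modS r : exists n, rep (modS r) = r + 2 * n%:~R.
Proof.
by exists (- Num.ceil ((r - 1) / 2)); rewrite /= /modS_rep mulrNz mulrN.
Qed.

Lemma rep_uniq x r n : -1 < r <= 1 -> rep x = r + 2 * n%:~R -> rep x = r.
Proof.
case: x => x /= /andP[? ?] /andP[? ?] xE.
suff n0 : n = 0 by rewrite xE n0 mulr0 addr0.
have [n0|n0|//] := ltgtP n 0.
  have : n%:~R <= -1 :> R by rewrite -[-1]/((-1)%:~R : R) ler_int; lia.
  by move=> ?; exfalso; lra.
have : 1 <= n%:~R :> R by rewrite -[1]/(1%:~R : R) ler_int; lia.
by move=> ?; exfalso; lra.
Qed.

Lemma modSK x : modS (rep x) = x.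
Proof.
apply/val_inj; have [n] := rep_modS (rep x).
by move=> /(rep_uniq (rep_itv x)).
Qed.

Lemma rep_modS_small r : -1 < r <= 1 -> rep (modS r) = r.
Proof. by move=> r1; have [n /(rep_uniq r1)] := rep_modS r. Qed.

Lemma modSD r n : modS (r + 2 * n%:~R) = modS r.
Proof.
apply/val_inj => /=.
have /= [m mE] := rep_modS r; have /= [p pE] := rep_modS (r + 2 * n%:~R).
apply: (@rep_uniq (modS (r + 2 * n%:~R)) _ (n + p - m)); first exact: modS_subproof.
by rewrite /= pE mE !rmorphD rmorphN/=; ring.
Qed.

Lemma rep_le1 x : `|rep x| <= 1.
Proof. by case: x => x /= ?; rewrite ler_norml; lra. Qed.

Lemma cnorm_ge0 r : 0 <= cnorm r. Proof. exact: normr_ge0. Qed.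
Lemma cnorm_le1 r : cnorm r <= 1. Proof. exact: rep_le1. Qed.

Lemma cnormD2 r n : cnorm (r + 2 * n%:~R) = cnorm r.
Proof. by rewrite /cnorm modSD. Qed.

Lemma cnorm_small r : `|r| <= 1 -> cnorm r = `|r|.
Proof.
rewrite ler_norml => /andP[r1 r2]; have [->|rN1] := eqVneq r (-1).
  rewrite -(cnormD2 (-1) 1)/= /cnorm rep_modS_small; last by lra.
  by rewrite normrN normr1 ger0_norm; lra.
by rewrite /cnorm rep_modS_small// r2 lt_neqAle r1 eq_sym rN1.
Qed.

Lemma cnorm_le r : cnorm r <= `|r|.
Proof.
have [/cnorm_small->//|r1] := leP `|r| 1.
by rewrite (le_trans (cnorm_le1 r))// ltW.
Qed.

Lemma cnormN r : cnorm (- r) = cnorm r.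
Proof.
have [n nE] := rep_modS r; have -> : - r = - rep (modS r) + 2 * n%:~R.
  by rewrite nE; ring.
by rewrite cnormD2 cnorm_small ?normrN// rep_le1.
Qed.

Lemma cnorm_modS r r' : cnorm (rep (modS r) + r') = cnorm (r + r').
Proof. by have [n ->] := rep_modS r; rewrite addrAC cnormD2. Qed.

Lemma cnormD r r' : cnorm (r + r') <= cnorm r + cnorm r'.
Proof.
rewrite -cnorm_modS addrC -cnorm_modS (le_trans (cnorm_le _))//.
by rewrite addrC ler_normD.
Qed.

Lemma circle_distE x y : circle_dist x y = cnorm (rep x - rep y).
Proof.
case: x y => x hx [y hy]; rewrite /circle_dist/=.
move: hx hy => /andP[? ?] /andP[? ?].
have [xy1|xy1] := leP `|x - y| 1; first by rewrite cnorm_small ?min_l//; lra.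
rewrite min_r; last by lra.
have [xy0|xy0] := leP 0 (x - y).
  move: xy1; rewrite (ger0_norm xy0) => xy1.
  rewrite -(cnormD2 _ (-1)) cnorm_small ?ler_norml; last by lra.
  by rewrite ler0_norm; lra.
move: xy1; rewrite (ltr0_norm xy0) => xy1.
rewrite -(cnormD2 _ 1) cnorm_small ?ler_norml; last by lra.
by rewrite ger0_norm; lra.
Qed.

Lemma cnorm_modSB r r' : cnorm (rep (modS r) - rep (modS r')) = cnorm (r - r').
Proof. by rewrite cnorm_modS -cnormN opprB cnorm_modS -cnormN opprB. Qed.

Lemma norm_direction x b : `|direction x b| = `|rep x|.
Proof.
rewrite /direction; case: eqP => [->|_]//.
by case: b; rewrite ?normrN ?normr1.
Qed.

(** Both tie-breaking values 1 and -1 lift the antipodal class, so the gap estimates do not see the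
    coin. *)
Lemma direction_mod r b : exists n, direction (modS r) b = r + 2 * n%:~R.
Proof.
rewrite /direction; have [m mE] := rep_modS r.
case: eqP => [e1|_]; last by exists m.
move: mE; rewrite e1 => mE; case: b; first by exists m.
by exists (m - 1); rewrite rmorphB/= mulrBr addrA -mE; lra.
Qed.

End circle.

(** * Interactions and trajectories *)

Section interaction.
Context {R : realType}.
Variable mu : R.
Implicit Types (x : config R) (e v k : int) (b : bool).

Definition gap e x : R := cnorm (rep (x (e + 1)) - rep (x e)).

Definition spin e b x : R := direction (modS (rep (x (e + 1)) - rep (x e))) b.

Definition interact e b x : config R := fun v =>
  if v == e then modS (rep (x e) + mu * spin e b x)
  else if v == e + 1 then modS (rep (x (e + 1)) - mu * spin e b x)
  else x v.

Lemma gap_ge0 e x : 0 <= gap e x. Proof. exact: cnorm_ge0. Qed.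
Lemma gap_le1 e x : gap e x <= 1. Proof. exact: cnorm_le1. Qed.

Lemma gap_local e x y : x e = y e -> x (e + 1) = y (e + 1) -> gap e x = gap e y.
Proof. by rewrite /gap => -> ->. Qed.

Lemma gap_eq0 e x : (gap e x == 0) = (x e == x (e + 1)).
Proof.
rewrite /gap -circle_distE; apply/eqP/eqP => [|->]; last first.
  by rewrite circle_distE subrr cnorm_small normr0.
by move=> h; symmetry; apply: metric_structure.mdist_positivity.
Qed.

Lemma norm_spin e b x : `|spin e b x| = gap e x.
Proof. by rewrite norm_direction. Qed.

Lemma interact_left e b x :
  interact e b x e = modS (rep (x e) + mu * spin e b x).
Proof. by rewrite /interact eqxx. Qed.

Lemma interact_right e b x :
  interact e b x (e + 1) = modS (rep (x (e + 1)) - mu * spin e b x).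
Proof. by rewrite /interact eqxx ifF//; lia. Qed.

Lemma interact_far e b x v : v != e -> v != e + 1 -> interact e b x v = x v.
Proof. by rewrite /interact => /negPf -> /negPf ->. Qed.

Lemma gap_interact_far e b x k :
  k != e - 1 -> k != e -> k != e + 1 -> gap k (interact e b x) = gap k x.
Proof. by move=> *; apply: gap_local; rewrite interact_far//; lia. Qed.

Section pathwise.
Variables (ring : int -> nat -> R) (coin : int -> nat -> bool).
Variables (x : config R) (y : R -> config R).
Hypothesis ytraj : trajectory mu ring coin x y.

Definition quiet (k : int) (t : R) := forall n, t < ring k n.

Lemma quiet_trajectory t v : 0 <= t -> quiet (v - 1) t -> quiet v t -> y t v = x v.
Proof.
move=> t0 q1 q2; rewrite -(trajectory_start ytraj).
apply: (trajectory_rest ytraj); first by rewrite lexx.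
by move=> n; rewrite !negb_and -!ltNge (q1 n) (q2 n) !orbT.
Qed.

Lemma quiet_le k s t : s <= t -> quiet k t -> quiet k s.
Proof. by move=> st q n; apply: le_lt_trans (q n). Qed.

(** If the ringing edge [e] is one of the edges [v - 1] and [v] at [v], the edges next to [e] must
    be silent too, so that both ends of [e] still carry their initial opinions when it rings. Over
    the two positions of [e] this involves the edges from [v - 2] to [v + 1]. *)
Lemma single_ring_trajectory t e v : 0 <= t ->
    0 < ring e 0%N <= t -> (forall n, t < ring e n.+1) ->
    {in [:: v - 2; v - 1; v; v + 1], forall k, k != e -> quiet k t} ->
  y t v = interact e (coin e 0%N) x v.
Proof.
move=> t0 /andP[T0 Tt] qe q.
have qv k : k \in [:: v - 2; v - 1; v; v + 1] -> k != e -> quiet k t by exact: q.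
have [veqe|vne] := boolP ((v == e) || (v == e + 1)); last first.
  move: vne; rewrite negb_or => /andP[v1 v2].
  rewrite interact_far//; apply: quiet_trajectory => //; apply: qv.
  - by rewrite !inE eqxx orbT.
  - by lia.
  - by rewrite !inE eqxx !orbT.
  - by lia.
have [r [r0 rT [yl yr]]] : exists r, [/\ 0 <= r, r < ring e 0%N &
    let sigma := direction (modS (rep (y r (e + 1)) - rep (y r e))) (coin e 0%N) in
    y (ring e 0%N) e = modS (rep (y r e) + mu * sigma) /\
    y (ring e 0%N) (e + 1) = modS (rep (y r (e + 1)) - mu * sigma)].
  near (ring e 0%N)^'- => r; exists r; split.
  - by near: r; apply: nbhs_left_ge.
  - by near: r; exact: nbhs_left_lt.
  - by near: r; exact: (trajectory_jump ytraj e 0).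
have rt : r < t by rewrite (lt_le_trans rT).
have qer : quiet e r.
  by case=> [//|n]; rewrite (lt_trans _ (qe n)).
have rest : quiet (v - 1) t \/ v - 1 = e -> quiet v t \/ v = e ->
    y t v = y (ring e 0%N) v.
  move=> q1 q2; apply: (trajectory_rest ytraj); first by rewrite (ltW T0).
  have qn k n : quiet k t \/ k = e -> ~~ (ring e 0%N < ring k n <= t).
    case=> [qk|->]; first by rewrite negb_and -ltNge (qk n) orbT.
    by case: n => [|n]; rewrite negb_and -?leNgt ?lexx// -ltNge qe orbT.
  by move=> n; rewrite !qn.
have [qm qp] : quiet (e - 1) t /\ quiet (e + 1) t.
  by case/orP : veqe => /eqP vE; subst v; split; apply: qv;
    rewrite ?inE ?addrK ?eqxx ?orbT//; lia.
have yre : y r e = x e.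
  by apply: quiet_trajectory => //; apply: quiet_le qm; exact: ltW.
have yre1 : y r (e + 1) = x (e + 1).
  apply: quiet_trajectory => //; first by rewrite addrK.
  by apply: quiet_le qp; exact: ltW.
move: yl yr; rewrite yre yre1 -/(spin e _ x) => yl yr.
case/orP : veqe => /eqP vE; subst v.
  by rewrite interact_left rest//; [left|right].
by rewrite interact_right rest//; [right; rewrite addrK|left].
Unshelve. all: by end_near. Qed.

End pathwise.

Hypothesis mu01 : 0 < mu <= 1 / 2.

(** The new difference lifts to [(1 - 2 * mu) * spin e b x]; as [mu <= 1 / 2] makes the factor
    nonnegative, this stays in [-1, 1] and no wrapping occurs. *)
Lemma gap_interact_same e b x : gap e (interact e b x) = (1 - 2 * mu) * gap e x.
Proof.
rewrite /gap interact_left interact_right cnorm_modSB.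
have [n nE] := direction_mod (rep (x (e + 1)) - rep (x e)) b.
rewrite -(cnormD2 _ n) -[cnorm (rep (x _) - _)](norm_spin e b x).
set r := (X in cnorm X); have -> : r = (1 - 2 * mu) * spin e b x.
  by rewrite /spin nE/r /spin nE; ring.
have h0 : 0 <= 1 - 2 * mu by case/andP: mu01; lra.
rewrite cnorm_small normrM (ger0_norm h0)//.
have := gap_le1 e x; have := gap_ge0 e x; rewrite norm_spin.
by case/andP: mu01; nra.
Qed.

Lemma cnorm_spin e b x r : cnorm (r + mu * spin e b x) <= cnorm r + mu * gap e x.
Proof.
rewrite (le_trans (cnormD _ _))// lerD2l (le_trans (cnorm_le _))//.
by rewrite normrM norm_spin ger0_norm//; case/andP: mu01 => /ltW.
Qed.

Lemma gap_interact_next e b x :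
  gap (e + 1) (interact e b x) <= gap (e + 1) x + mu * gap e x.
Proof.
rewrite {1}/gap interact_right interact_far; [|lia|lia].
rewrite -cnormN opprB cnorm_modS.
rewrite (_ : _ - _ - _ = - (rep (x (e + 1 + 1)) - rep (x (e + 1)) +
  mu * spin e b x)); last by ring.
by rewrite cnormN; exact: cnorm_spin.
Qed.

Lemma gap_interact_prev e b x :
  gap (e - 1) (interact e b x) <= gap (e - 1) x + mu * gap e x.
Proof.
rewrite {1}/gap subrK interact_left interact_far; [|lia|lia].
by rewrite cnorm_modS addrAC /gap subrK; exact: cnorm_spin.
Qed.

End interaction.

Section consensus_trajectory.
Context {R : realType}.
Variables (mu : R) (ring : int -> nat -> R) (coin : int -> nat -> bool).
Variables (s : opinion R) (y : R -> config R).
Hypothesis ytraj : trajectory mu ring coin (consensus s) y.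

Lemma direction0 b : direction (modS 0 : opinion R) b = 0.
Proof.
have rep0 : rep (modS 0 : opinion R) = 0 by rewrite rep_modS_small//; lra.
by rewrite /direction rep0; case: eqP => // ?; lra.
Qed.

(** The silent edges [a] and [b] isolate the vertices [a + 1], ..., [b]. Induction on the number of
    rings of the block in (0, r]: just before the last ring that touches [v] fewer rings have
    occurred, so both ends carry [s], and an interaction between equal opinions does nothing. *)
Lemma consensus_block (a b : int) (t : R) (N : nat) : a <= b ->
    quiet ring a t -> quiet ring b t ->
    (forall e n, a <= e <= b -> (N <= n)%N -> t < ring e n) ->
  forall r v, 0 <= r <= t -> a < v <= b -> y r v = s.
Proof.
move=> ab qa qb qN.
(* Rings numbered [N] or more come after [t], so this finite type indexes every ring of the block up
   to [t]. *)
pose m := `|b - a|%N.+1; pose E (i : 'I_m * 'I_N) : int := a + (i.1 : nat)%:Z.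
pose T i := ring (E i) i.2.
pose rung r := [set i | (0 < T i) && (T i <= r)]%SET.
have EP e n : a <= e <= b -> (n < N)%N -> exists i : 'I_m * 'I_N, e = E i /\ n = i.2.
  move=> eab nN; have em : (`|e - a| < m)%N by rewrite /m; lia.
  by exists (Ordinal em, Ordinal nN); split=> //; rewrite /E/=; lia.
move=> r v; have [k] := ubnP #|rung r|; elim: k r v => // k IHk r v kr.
move=> /andP[r0 rt] /andP[av vb].
pose P i := [&& (E i == v - 1) || (E i == v), 0 < T i & T i <= r].
have rest u : 0 <= u <= r -> (forall i, P i -> T i <= u) -> y r v = y u v.
  move=> ur Pu; apply: (trajectory_rest ytraj) => // n.
  have F e : (e == v - 1) || (e == v) -> ~~ (u < ring e n <= r).
    move=> ev; apply/negP => /andP[un nr].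
    have eab : a <= e <= b by lia.
    have [nN|Nn] := ltnP n N; last first.
      by have := qN e n eab Nn; rewrite ltNge (le_trans nr rt).
    have [i [eE nE]] := EP e n eab nN; have Pi : P i.
      by rewrite /P /T -eE -nE ev nr andbT (le_lt_trans _ un)//; case/andP: ur.
    by have := Pu i Pi; rewrite /T -eE -nE leNgt un.
  by rewrite !F ?eqxx ?orbT.
have [i0 Pi0|noP] := pickP P; last first.
  rewrite (rest 0) ?lexx//; last by move=> i; rewrite noP.
  by rewrite (trajectory_start ytraj).
case: (@arg_maxP _ _ _ i0 P T Pi0) => i Pi maxi.
rewrite (rest (T i)); last exact: maxi; last first.
  by case/and3P: Pi => _ /ltW -> ->.
move: (Pi); rewrite /P => /and3P[Ev T0 Tr].
(* The edge [E i] rings by time [t], hence is neither [a] nor [b], and both its ends lie in the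
   block. *)
have /and3P[aE Eb _] : [&& a < E i, E i < b & true].
  rewrite andbT; have qab e : e = a \/ e = b -> E i != e.
    move=> eab; apply/eqP => Ee; have := leNgt (T i) t.
    rewrite (le_trans Tr rt) /T Ee; case: eab => ->; first by rewrite qa.
    by rewrite qb.
  have := qab a (or_introl erefl); have := qab b (or_intror erefl).
  by rewrite /E in Ev *; lia.
(* Just before [T i] the index [i] is no longer in [rung u], so the induction hypothesis applies at
   time [u]. *)
near (T i)^'- => u.
have u0 : 0 <= u by near: u; apply: nbhs_left_ge.
have uT : u < T i by near: u; exact: nbhs_left_lt.
have uk : (#|rung u| < k)%N.
  rewrite -ltnS; apply: leq_trans kr; rewrite ltnS; apply: proper_card.
  apply/properP; split; last exists i.
  - apply/fintype.subsetP => j; rewrite !inE => /andP[-> /= /le_trans]; apply.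
    exact: ltW (lt_le_trans uT Tr).
  - by rewrite inE T0.
  - by rewrite inE T0/= -ltNge.
have ut : 0 <= u <= t by rewrite u0 (ltW (lt_le_trans uT (le_trans Tr rt))).
have yE : y u (E i) = s by apply: IHk => //; rewrite aE ltW.
have yE1 : y u (E i + 1) = s by apply: IHk => //; lia.
have : let sigma := direction (modS (rep (y u (E i + 1)) - rep (y u (E i)))) (coin (E i) i.2) in
    y (T i) (E i) = modS (rep (y u (E i)) + mu * sigma) /\
    y (T i) (E i + 1) = modS (rep (y u (E i + 1)) - mu * sigma).
  by near: u; exact: (trajectory_jump ytraj (E i) i.2).
rewrite /= yE yE1 subrr direction0 mulr0 addr0 subr0 modSK => -[yTE yTE1].
case/orP : Ev => /eqP Ev; last by rewrite -Ev.
by have -> : v = E i + 1 by rewrite Ev subrK.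
Unshelve. all: by end_near. Qed.

End consensus_trajectory.

(** * The Poisson clocks *)

Section countable_ae.
Context d (T : measurableType d) (R : realType) (P : {measure set T -> \bar R}).

Lemma ae_imp (A B : T -> Prop) : (forall w, A w -> B w) ->
  {ae P, forall w, A w} -> {ae P, forall w, B w}.
Proof. exact: filterS. Qed.

Lemma ae_and (A B : T -> Prop) : {ae P, forall w, A w} -> {ae P, forall w, B w} ->
  {ae P, forall w, A w /\ B w}.
Proof. by move=> ? ?; exact: filterI. Qed.

Lemma ae_forall_countable (I : countType) (Q : I -> T -> Prop) :
  (forall i, {ae P, forall w, Q i w}) -> {ae P, forall w, forall i, Q i w}.
Proof.
move=> aeQ; have : {ae P, forall w, forall n : nat,
    if unpickle n is Some i then Q i w else True}.
  by apply/ae_foralln => n; case: (unpickle n) => [i|]; [exact: aeQ|exact: aeW].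
by apply: filterS => w Qw i; have := Qw (pickle i); rewrite pickleK.
Qed.

End countable_ae.

Section noise.
Context {R : realType} d (Omega : measurableType d) (P : probability Omega R).
Variables (tau : int -> nat -> {RV P >-> R}) (xi : int -> nat -> {RV P >-> bool}).
Hypothesis noise : graphical_noise tau xi.

Lemma measurable_tau_le e n t : measurable [set w | tau e n w <= t].
Proof.
rewrite -[X in measurable X]setTI; have := measurable_funPT (tau e n).
by move/(_ measurableT `]-oo, t]%classic (measurable_itv _)); rewrite set_itvE.
Qed.

Lemma measurable_tau_gt e n t : measurable [set w | t < tau e n w].
Proof.
rewrite -[X in measurable X]setTI; have := measurable_funPT (tau e n).
by move/(_ measurableT `]t, +oo[%classic (measurable_itv _)); rewrite set_itvE.
Qed.

Lemma prob_tau_le e n t : 0 < t ->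
  P [set w | tau e n w <= t] = (1 - expR (- t))%:E.
Proof.
move=> t0; have := noise_exponential noise e n (measurable_itv `]-oo, t]).
rewrite /distribution /pushforward {1}set_itvE => ->.
have := exponential_prob_itv0c 1 t0; rewrite mulN1r => /esym.
rewrite EFinB => ->; rewrite /exponential_prob integral_mkcond [RHS]integral_mkcond.
congr integral; apply/funext => x; rewrite /patch !mem_setE !in_itv/=.
have [//|x0] := leP 0 x.
by rewrite lt0_exponential_pdf//=; case: ifP.
Qed.

Lemma prob_tau_gt e n t : 0 < t -> P [set w | t < tau e n w] = (expR (- t))%:E.
Proof.
move=> t0; have -> : [set w | t < tau e n w] = ~` [set w | tau e n w <= t].
  by apply/seteqP; split=> w /=; [rewrite ltNge => /negP|move/negP; rewrite ltNge].
rewrite probability_setC ?prob_tau_le//; last exact: measurable_tau_le.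
by rewrite -EFinB opprB addrC subrK.
Qed.

Lemma prob_xi e n b : P [set w | xi e n w = b] = (1 / 2)%:E.
Proof.
have := noise_fair noise e n (A := [set b]) I.
rewrite /distribution /pushforward => -> .
rewrite bernoulli_probE; last by apply/andP; split; lra.
rewrite !diracE; case: b.
  by rewrite [true \in _]mem_set// [false \in _]memNset// mule1 mule0 adde0.
rewrite [true \in _]memNset// [false \in _]mem_set// mule1 mule0 add0e.
by congr EFin; rewrite /unstable.onem; lra.
Qed.

Lemma tau_gt0_ae : {ae P, forall w, forall e n, 0 < tau e n w}.
Proof.
suff H : forall i : int * nat, {ae P, forall w, 0 < tau i.1 i.2 w}.
  by apply: filterS (ae_forall_countable H) => w Hw e n; exact: (Hw (e, n)).
move=> [e n] /=; exists [set w | tau e n w <= 0]; split; last 2 first.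
(* The event [tau <= 0] lies in [tau <= t], of probability 1 - e^{-t} <= t, for every t > 0. *)
- by apply/eqP; rewrite eq_le measure_ge0 andbT; apply/lee_addgt0Pr => t t0;
    rewrite add0e; apply: (@le_trans _ _ (P [set w | tau e n w <= t]));
    [apply: le_measure; rewrite ?inE//; [exact: measurable_tau_le|
       exact: measurable_tau_le|by move=> w /= /le_trans; apply; exact: ltW]|
     rewrite prob_tau_le// lee_fin; have := expR_ge1Dx (- t); lra].
- by move=> w /= /negP; rewrite -leNgt.
- exact: measurable_tau_le.
Qed.

Lemma prob_tau_bigcap (s : seq (int * nat)) t : 0 < t -> uniq s ->
  P (\bigcap_(i in [set` s]) [set w | tau i.1 i.2 w <= t]) =
  ((1 - expR (- t)) ^+ size s)%:E.
Proof.
move=> t0 us.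
pose A (i : (int * nat) + (int * nat)) := match i with
  | inl i => [set w | tau i.1 i.2 w <= t] | inr _ => setT end.
have := noise_independent noise (s := map inl s) (A := A).
rewrite map_inj_uniq//; last by move=> ? ? [].
move=> /(_ us); rewrite big_map => H.
rewrite (_ : \bigcap_(i in _) _ = \bigcap_(i in [set` [seq inl i | i <- s]]) A i).
  rewrite H.
    rewrite (eq_bigr (fun=> (1 - expR (- t))%:E)) => [|i _]; last exact: prob_tau_le.
    by rewrite -(big_morph EFin (@EFinM R) erefl) big_const_seq count_predT iter_mulr mulr1.
  move=> _ /mapP[[e n] _ ->]; exists `]-oo, t]%classic; first exact: measurable_itv.
  by rewrite setTI set_itvE.
apply/seteqP; split=> w /= H'.
  by move=> _ /= /mapP[i si ->]; exact: H'.
by move=> i /= si; apply: (H' (inl i)); apply/mapP; exists i.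
Qed.

(** The first k of these waits are all at most [t] with probability (1 - e^{-t})^k, which tends to
    0. Run over edges, this yields silent edges on both sides of a vertex; run over the waits of one
    edge, it makes its ring times diverge. *)
Lemma tau_gt_ae (j : nat -> int * nat) t : injective j -> 0 < t ->
  {ae P, forall w, exists k, t < tau (j k).1 (j k).2 w}.
Proof.
move=> jI t0; pose B := \bigcap_k [set w | tau (j k).1 (j k).2 w <= t].
have mB : measurable B by apply: bigcapT_measurable => k; exact: measurable_tau_le.
exists B; split=> //; last first.
  move=> w /= H k _ /=; rewrite leNgt; apply/negP => tk; apply: H.
  by exists k.
pose q := 1 - expR (- t).
have q0 : 0 <= q by rewrite subr_ge0 expR_le1; lra.
have q1 : q < 1 by rewrite gtrBl expR_gt0.
have qk0 : (fun k => (q ^+ k)%:E) @ \oo --> 0%E.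
  by apply: cvg_EFin; [exact: nearW|apply: cvg_expr; rewrite ger0_norm].
apply/eqP; rewrite eq_le measure_ge0 andbT.
apply: (cvge_ge _ qk0); apply: nearW => k.
have uk : uniq (map j (iota 0 k)) by rewrite map_inj_uniq ?iota_uniq.
have := prob_tau_bigcap t0 uk; rewrite size_map size_iota => <-.
apply: le_measure; rewrite ?inE//.
  by apply: fin_bigcap_measurable => // i _; exact: measurable_tau_le.
by move=> w Bw _ /= /mapP[i _ ->]; exact: Bw.
Qed.

End noise.

Section noise_paths.
Context {R : realType} d (Omega : measurableType d) (P : probability Omega R).
Variables (tau : int -> nat -> {RV P >-> R}) (xi : int -> nat -> {RV P >-> bool}).

Section deterministic.
Variable w : Omega.
Hypothesis tau0 : forall e n, 0 < tau e n w.

Lemma ring_time0 e : ring_time tau w e 0 = tau e 0 w.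
Proof. by rewrite /ring_time big_ord1. Qed.

Lemma ring_timeS e n : ring_time tau w e n.+1 = ring_time tau w e n + tau e n.+1 w.
Proof. by rewrite /ring_time big_ord_recr. Qed.

Lemma ring_time_le e m n : (m <= n)%N -> ring_time tau w e m <= ring_time tau w e n.
Proof.
move=> /subnK <-; elim: (n - m)%N => // k; rewrite addSn ring_timeS => /le_trans.
by apply; rewrite lerDl ltW.
Qed.

Lemma quiet_first e t : t < tau e 0 w -> quiet (ring_time tau w) e t.
Proof. by rewrite -ring_time0 => te n; apply: lt_le_trans te (ring_time_le _ _). Qed.

Lemma ring_time_diverges e : (forall m, exists k, 1 < tau e (m + k) w) ->
  forall t, exists N, forall n, (N <= n)%N -> t < ring_time tau w e n.
Proof.
move=> He; have HM M : exists N, M%:R <= ring_time tau w e N.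
  elim: M => [|M [N MN]]; first by exists 0%N; rewrite ring_time0 ltW.
  have [k k1] := He N.+1; exists (N.+1 + k)%N.
  rewrite addSn ring_timeS -natr1 lerD//; last by rewrite -addSn ltW.
  by rewrite (le_trans MN)// ring_time_le// leq_addr.
move=> t; have [N MN] := HM (Num.truncn `|t|).+1; exists N => n Nn.
rewrite (le_lt_trans (ler_norm t))// (lt_le_trans (truncnS_gt _))//.
by rewrite (le_trans MN)// ring_time_le.
Qed.

End deterministic.

Section window.
Variables (a : int) (n : nat) (t : R).
Implicit Types o : option ('I_n * bool).

(* [None]: no edge of the window {a, ..., a + n - 1} rings up to time t;
   [Some (j, b)]: only the edge a + j does, exactly once, with coin b. *)
Definition clock_event o (i : (int * nat) + (int * nat)) : set Omega :=
  match i, o with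
  | inl (e, 0%N), Some (j, _) =>
      if e == a + (j : nat)%:Z then [set w | tau e 0%N w <= t]
      else [set w | t < tau e 0%N w]
  | inl (e, m), _ => [set w | t < tau e m w]
  | inr (e, m), Some (_, b) => [set w | xi e m w = b]
  | _, _ => setT
  end.

(** A second wait beyond [t] is stronger than a second ring beyond [t], but it keeps each condition
    on a variable of its own, so that independence turns the probability into a product. *)
Definition clock_indices o : seq ((int * nat) + (int * nat)) :=
  [seq inl (a + (i : nat)%:Z, 0%N) | i : 'I_n <- enum 'I_n] ++
  (if o is Some (j, _) then [:: inl (a + (j : nat)%:Z, 1%N); inr (a + (j : nat)%:Z, 0%N)]
   else [::]).

Definition window_event o : set Omega :=
  \bigcap_(i in [set` clock_indices o]) clock_event o i.

Lemma measurable_clock_event o i : measurable (clock_event o i).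
Proof.
case: i => -[e m].
  have mgt k : measurable [set w | t < tau e k w] by exact: measurable_tau_gt.
  case: m o => [|m] [[j b]|] //=; case: ifP => // _; exact: measurable_tau_le.
case: o => [[j b]|] //=; rewrite -[X in measurable X]setTI.
by have := measurable_funPT (xi e m) measurableT [set b] I.
Qed.

Lemma measurable_window_event o : measurable (window_event o).
Proof.
by apply: fin_bigcap_measurable => // i _; exact: measurable_clock_event.
Qed.

Lemma window_eventP o w : window_event o w <->
  (forall i : 'I_n, if o is Some (j, _) then if i == j
     then tau (a + (i : nat)%:Z) 0 w <= t else t < tau (a + (i : nat)%:Z) 0 w
     else t < tau (a + (i : nat)%:Z) 0 w) /\
  (if o is Some (j, b) then
     t < tau (a + (j : nat)%:Z) 1 w /\ xi (a + (j : nat)%:Z) 0 w = b else True).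
Proof.
have eqij (i j : 'I_n) : (a + (i : nat)%:Z == a + (j : nat)%:Z) = (i == j).
  by apply/eqP/eqP => [|->//] H; apply/val_inj => /=; lia.
split=> [H|[H1 H2]].
  split=> [i|].
    have := H (inl (a + (i : nat)%:Z, 0%N)).
    rewrite /= mem_cat map_f ?mem_enum// => /(_ isT).
    by case: o {H} => [[j b]|] //=; rewrite eqij; case: ifP.
  case: o H => [[j b]|] //= H; split.
    by apply: (H (inl (a + (j : nat)%:Z, 1%N))); rewrite /= mem_cat !inE eqxx orbT.
  by apply: (H (inr (a + (j : nat)%:Z, 0%N))); rewrite /= mem_cat !inE eqxx !orbT.
move=> k /=; rewrite mem_cat => /orP[/mapP[i _ ->]|].
  by have := H1 i; case: o {H1 H2} => [[j b]|] //=; rewrite eqij; case: ifP.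
case: o H1 H2 => [[j b]|] //= H1 [H2 H3].
by rewrite !inE => /orP[] /eqP ->.
Qed.

Lemma window_event_disjoint o o' w : window_event o w -> window_event o' w -> o = o'.
Proof.
move=> /window_eventP[H1 H2] /window_eventP[H1' H2'].
case: o o' H1 H2 H1' H2' => [[j b]|] [[j' b']|] //.
- move=> H1 [_ <-] H1' [_ <-].
  have [<-//|jj'] := eqVneq j j'.
  by have := H1 j; have := H1' j; rewrite eqxx (negPf jj') => /lt_le_trans /[apply]; rewrite ltxx.
- by move=> H1 _ /(_ j); have := H1 j; rewrite eqxx => /le_lt_trans /[apply]; rewrite ltxx.
- by move=> H1 _ H1' _; have := H1 j'; have := H1' j'; rewrite eqxx => /le_lt_trans /[apply]; rewrite ltxx.
Qed.

Hypothesis noise : graphical_noise tau xi.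
Hypothesis t0 : 0 < t.

(** The exponent is [n] in both cases: with a ring, the [n - 1] other edges are silent and the
    second wait of the ringing edge gives the last factor. *)
Lemma prob_window_event o : P (window_event o) =
  (if o is Some _ then (1 - expR (- t)) * expR (- t) ^+ n * (1 / 2)
   else expR (- t) ^+ n)%:E.
Proof.
rewrite (noise_independent noise); first last.
- move=> i _; case: i => -[e m] /=.
    have Hgt k : preimage_set_system setT (tau e k) measurable [set w | t < tau e k w].
      exists `]t, +oo[%classic; first exact: measurable_itv.
      by rewrite setTI set_itvE.
    have Hle k : preimage_set_system setT (tau e k) measurable [set w | tau e k w <= t].
      exists `]-oo, t]%classic; first exact: measurable_itv.
      by rewrite setTI set_itvE.
    by case: m o => [|m] [[j b]|] //=; case: ifP.
  case: o => [[j b]|] /=; first by exists [set b] => //; rewrite setTI.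
  by exists setT => //; rewrite setTI.
- rewrite /clock_indices cat_uniq map_inj_uniq ?enum_uniq/=; last first.
    by move=> i j []; move=> H; apply/val_inj; move: H => /=; lia.
  case: o => [[j b]|//]; rewrite /= andbT !negb_or; apply/andP; split=> //.
    by apply/mapP => -[].
  by rewrite andbT; apply/mapP => -[].
rewrite /clock_indices big_cat big_map big_enum/=.
have P0 (i : 'I_n) : P (clock_event o (inl (a + (i : nat)%:Z, 0%N))) =
    (if o is Some (j, _) then if i == j then 1 - expR (- t) else expR (- t)
     else expR (- t))%:E.
  case: o => [[j b]|] /=; last exact: (prob_tau_gt noise).
  have -> : (a + i%:Z == a + j%:Z) = (i == j).
    by apply/eqP/eqP => [|->//] H; apply/val_inj => /=; lia.
  by case: ifP => _; [exact: (prob_tau_le noise)|exact: (prob_tau_gt noise)].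
under eq_bigr do rewrite P0; rewrite -(big_morph EFin (@EFinM R) erefl).
case: o {P0} => [[j b]|]; last first.
  by rewrite big_nil mule1 prodr_const card_ord.
rewrite !big_cons big_nil mule1 (prob_tau_gt noise)// (prob_xi noise).
rewrite -!EFinM; congr EFin; rewrite mulrA; congr (_ * _).
rewrite (bigD1 j)//= eqxx -!mulrA; congr (_ * _).
rewrite (eq_bigr (fun=> expR (- t))) => [|i /negPf ->//].
rewrite prodr_const cardC1 card_ord -exprSr prednK//.
exact: leq_ltn_trans (ltn_ord j).
Qed.

End window.

End noise_paths.

(** * Reading the flow off the clocks of a window *)

Section flow.
Context {R : realType} (mu : R).
Context d (Omega : measurableType d) (P : probability Omega R).
Variables (tau : int -> nat -> {RV P >-> R}) (xi : int -> nat -> {RV P >-> bool}).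
Variable eta : R -> {mfun (borel (config R) * Omega)%type >-> borel (config R)}.
Hypothesis noise : graphical_noise tau xi.
Hypothesis flow : compass_flow tau xi mu eta.

Definition jump (a : int) (n : nat) (o : option ('I_n * bool)) (x : config R) :
    config R :=
  if o is Some (j, b) then interact mu (a + (j : nat)%:Z) b x else x.

(** For these [v] the edges from [v - 2] to [v + 1] all belong to the window, as
    [single_ring_trajectory] requires. *)
Lemma flow_jump (x : config R) : {ae P, forall w, forall a n t (o : option ('I_n * bool)), 0 < t ->
  window_event tau xi a t o w -> forall v : int, a + 2 <= v <= a + n%:Z - 2 ->
  (eta t (x, w) : config R) v = jump a o x v}.
Proof.
apply: filterS2 (flow x) (tau_gt0_ae noise) => w traj tau0 a n t o t0.
move=> /window_eventP[H1 H2] v /andP[av vb].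
have quietW k : a <= k < a + n%:Z ->
    (if o is Some (j, _) then k != a + (j : nat)%:Z else true) ->
    quiet (ring_time tau w) k t.
  move=> /andP[ak kn] ko; apply: quiet_first => //.
  have jn : (`|k - a| < n)%N by lia.
  pose i := Ordinal jn; have kE : k = a + (i : nat)%:Z by rewrite /=; lia.
  have := H1 i; rewrite -kE; case: o ko {H1 H2} => [[j b]|//] kj.
  by case: eqP => // ij; move: kj; rewrite kE ij eqxx.
case: o H1 H2 quietW => [[j b]|] H1 H2 quietW /=; last first.
  by apply: (quiet_trajectory traj); [exact: ltW|apply: quietW => //; lia..].
case: H2 => Hj <-.
apply: (single_ring_trajectory traj); first exact: ltW.
- by rewrite ring_time0; have := H1 j; rewrite eqxx => ->; rewrite tau0.
- move=> k; apply: lt_le_trans (ring_time_le tau0 _ (ltn0Sn k)).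
  by rewrite ring_timeS ring_time0 (lt_trans Hj)// ltrDr.
- move=> k; rewrite !inE => kv kj; apply: quietW => //.
  by lia.
Qed.

End flow.

Lemma ptws_cvg (I : Type) (V : topologicalType) (F : set_system {ptws I -> V})
    (f : {ptws I -> V}) : Filter F ->
  (forall i, (fun g : I -> V => g i) @ F --> f i) -> F --> f.
Proof.
move=> FF Fi; apply/cvg_sup => i A; case=> B [[C oC <-] Cf] BA.
apply: (filterS BA); apply: Fi; exact: open_nbhs_nbhs.
Qed.

(** * Continuity and Borel measurability of the gaps *)

Section borel_measurability.
Context {R : realType}.

Lemma borel_measurable_fun (T U : ptopologicalType) (f : T -> U) :
  continuous f -> measurable_fun setT (f : borel T -> borel U).
Proof.
move=> cf; apply: (@measurability _ _ (borel T) (borel U) setT f open erefl).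
move=> _ [A oA <-]; rewrite setTI; apply: sub_sigma_algebra.
by apply: open_comp => // x _; exact: cf.
Qed.

Lemma borel_measurable_realfun (T : ptopologicalType) (f : T -> R) :
  continuous f -> measurable_fun setT (f : borel T -> R).
Proof.
move=> cf; apply: (measurability _ (measurable_realfun.RGenOInfty.measurableE R)) => //.
move=> _ [_ [a ->] <-]; rewrite setTI; apply: sub_sigma_algebra.
by apply: open_comp => [x _|]; [exact: cf|exact: interval_open].
Qed.

Lemma eval_continuous v : continuous (fun x : config R => x v).
Proof. exact: (@proj_continuous int (fun=> opinion R) v). Qed.

Lemma circle_ball (x y : opinion R) r : ball x r y = (circle_dist x y < r).
Proof. by rewrite metric_structure.ballEmdist. Qed.

Lemma circle_dist_lip (x y z : opinion R) :
  `|circle_dist x z - circle_dist y z| <= circle_dist x y.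
Proof.
rewrite !circle_distE ler_norml; apply/andP; split.
  rewrite lerNl opprB lerBlDl.
  have -> : rep y - rep z = (rep x - rep z) + - (rep x - rep y) by ring.
  by rewrite (le_trans (cnormD _ _))// cnormN.
have -> : rep x - rep z = (rep x - rep y) + (rep y - rep z) by ring.
by rewrite lerBlDr cnormD.
Qed.

Lemma circle_distC (x y : opinion R) : circle_dist x y = circle_dist y x.
Proof. by rewrite !circle_distE -cnormN opprB. Qed.

Lemma circle_dist_continuous (T : topologicalType) (f g : T -> opinion R) :
  continuous f -> continuous g -> continuous (fun x => circle_dist (f x) (g x)).
Proof.
move=> cf cg x; apply/cvgrPdist_lt => r r0.
have r20 : 0 < r / 2 by rewrite divr_gt0.
have ev (h : T -> opinion R) : continuous h ->
    \forall y \near x, circle_dist (h x) (h y) < r / 2.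
  move=> ch; have H : \forall y \near x, ball (h x) (r / 2) (h y).
    exact: (ch x _ (nbhsx_ballx (h x) (r / 2) r20)).
  by apply: filterS H => y; rewrite circle_ball.
near=> y.
have -> : circle_dist (f x) (g x) - circle_dist (f y) (g y) =
  (circle_dist (f x) (g x) - circle_dist (f y) (g x)) +
  (circle_dist (g x) (f y) - circle_dist (g y) (f y)).
  by rewrite [circle_dist (g x) _]circle_distC [circle_dist (g y) _]circle_distC; ring.
rewrite [r]splitr (le_lt_trans (ler_normD _ _))// ltrD//.
  by rewrite (le_lt_trans (circle_dist_lip _ _ _))//; near: y; exact: ev.
by rewrite (le_lt_trans (circle_dist_lip _ _ _))//; near: y; exact: ev.
Unshelve. all: by end_near. Qed.

Lemma gap_continuous e : continuous (gap e : config R -> R).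
Proof.
have -> : gap e = (fun x : config R => circle_dist (x (e + 1)) (x e)).
  by apply/funext => x; rewrite /gap circle_distE.
by apply: circle_dist_continuous; exact: eval_continuous.
Qed.

Lemma measurable_gap e : measurable_fun setT (gap e : borel (config R) -> R).
Proof. exact: (@borel_measurable_realfun (config R) _ (@gap_continuous e)). Qed.

Lemma consensus_continuous : continuous (@consensus R).
Proof.
by move=> s; apply: ptws_cvg => [|v]; [apply: fmap_filter; exact: nbhs_filter|exact: cvg_id].
Qed.

End borel_measurability.

(** * Stationary measures *)

Section flow_expectation.
Context {R : realType} (mu : R).
Context d (Omega : measurableType d) (P : probability Omega R).
Variables (tau : int -> nat -> {RV P >-> R}) (xi : int -> nat -> {RV P >-> bool}).
Variable eta : R -> {mfun (borel (config R) * Omega)%type >-> borel (config R)}.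
Hypothesis noise : graphical_noise tau xi.
Hypothesis flow : compass_flow tau xi mu eta.

(* The margin of two vertices makes the clocks of the window determine both
   opinions involved in an interaction that changes the opinion at v. *)
Definition window_local (a : int) (n : nat) (f : config R -> R) : Prop :=
  forall x y : config R, (forall v : int, a + 2 <= v <= a + n%:Z - 2 -> x v = y v) -> f x = f y.

Definition window_prob n t (o : option ('I_n * bool)) : R :=
  if o is Some _ then (1 - expR (- t)) * expR (- t) ^+ n * (1 / 2)
  else expR (- t) ^+ n.

Variables (a : int) (n : nat) (f : config R -> R).
Hypothesis mf : measurable_fun setT (f : borel (config R) -> R).
Hypothesis f01 : forall x, 0 <= f x <= 1.
Hypothesis flocal : window_local a n f.

Lemma measurable_flow t :
  measurable_fun setT (fun z : borel (config R) * Omega => f (eta t z)).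
Proof. exact: (measurableT_comp mf (measurable_funPT (eta t))). Qed.

Lemma measurable_flow2 t (x : config R) :
  measurable_fun setT (fun w : Omega => f (eta t (x, w))).
Proof.
apply: (measurableT_comp (measurable_flow t)).
exact: (@measurable_pair1 _ _ (borel (config R)) Omega x).
Qed.

Lemma flow_on_window (x : config R) : {ae P, forall w, forall t (o : option ('I_n * bool)),
  0 < t -> window_event tau xi a t o w -> f (eta t (x, w)) = f (jump mu a o x)}.
Proof.
apply: filterS (flow_jump noise flow x) => w H t o t0 wo.
by apply: flocal => v vW; exact: H wo v vW.
Qed.

(** The window events are disjoint and [f] is known on each; elsewhere only [f <= 1] is used, which
    is why the bound is written with the deficits [1 - f]. The remaining event has probability
    O(t^2), which is lost at first order as [t] tends to 0. *)
Lemma expect_flow_le t (x : config R) : 0 < t ->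
  (\int[P]_w (f (eta t (x, w)))%:E <=
   (1 - \sum_(o : option ('I_n * bool)) window_prob t o * (1 - f (jump mu a o x)))%:E)%E.
Proof.
move=> t0; pose c (o : option ('I_n * bool)) : R := 1 - f (jump mu a o x).
have c0 o : 0 <= c o by rewrite subr_ge0; case/andP: (f01 (jump mu a o x)).
pose W (o : option ('I_n * bool)) := window_event tau xi a t o.
have mW o : measurable (W o) by exact: measurable_window_event.
have mcW o : measurable_fun setT (fun w => (c o * \1_(W o) w)%:E).
  apply/measurable_EFinP; apply: measurable_funM; first exact: measurable_cst.
  exact: measurable_indic.
have cW0 o w : (0 <= (c o * \1_(W o) w)%:E)%E by rewrite lee_fin mulr_ge0.
have mF : measurable_fun setT (fun w => (f (eta t (x, w)))%:E).
  by apply/measurable_EFinP; exact: measurable_flow2.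
have F0 w : (0 <= (f (eta t (x, w)))%:E)%E by rewrite lee_fin; case/andP: (f01 (eta t (x, w))).
have cWE o : (\int[P]_w (c o * \1_(W o) w)%:E = (window_prob t o * c o)%:E)%E.
  under eq_integral do rewrite EFinM.
  rewrite ge0_integralZl_EFin//; last by apply/measurable_EFinP; exact: measurable_indic.
  rewrite integral_indic// setIT mulrC EFinM; congr (_ * _)%E.
  exact: (prob_window_event a noise).
rewrite EFinB leeBrDr// -sumEFin -(eq_bigr _ (fun o _ => cWE o)).
rewrite -ge0_integral_sum// -ge0_integralD//; last 2 first.
- by move=> w _; rewrite sume_ge0.
- exact: emeasurable_sum.
rewrite [leRHS](_ : _ = \int[P]_w (cst 1%E w))%E; last first.
  by rewrite integral_cst// mul1e; exact/esym/probability_setT.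
apply: ae_ge0_le_integral => //.
- by move=> w _; rewrite adde_ge0// sume_ge0.
- by apply: emeasurable_funD => //; exact: emeasurable_sum.
apply: filterS (flow_on_window x) => w Hw _ /=.
rewrite sumEFin -EFinD lee_fin.
have [[p Wp]|noW] := pselect (exists o, W o w).
  rewrite (bigD1 p)//= big1 => [|o op].
    by rewrite addr0 indicE mem_set// mulr1 /c (Hw t p)// addrC subrK.
  rewrite indicE memNset ?mulr0// => Wo; move/eqP: op; apply.
  exact: window_event_disjoint Wo Wp.
rewrite big1 ?addr0 => [|o _]; first by case/andP: (f01 (eta t (x, w))).
by rewrite indicE memNset ?mulr0// => Wo; apply: noW; exists o.
Qed.

(* Up to a constant factor, [f (jump mu a o x)] is the integral of
   [f (eta 1 (x, w))] over the event [o], hence measurable in [x] by Fubini. *)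
Lemma measurable_jump (o : option ('I_n * bool)) :
  measurable_fun setT (fun x : borel (config R) => f (jump mu a o x)).
Proof.
pose W := window_event tau xi a 1 o.
have mW : measurable W by exact: measurable_window_event.
pose g (z : borel (config R) * Omega) : \bar R := (f (eta 1 z) * \1_W z.2)%:E.
have mg : measurable_fun setT g.
  apply/measurable_EFinP; apply: measurable_funM; first exact: measurable_flow.
  by apply: measurableT_comp => //; exact: measurable_indic.
have g0 z : (0 <= g z)%E.
  by rewrite lee_fin mulr_ge0//; case/andP: (f01 (eta 1 z)).
have gE x : fubini_F P g x = (window_prob 1 o * f (jump mu a o x))%:E.
  rewrite /fubini_F.
  transitivity (\int[P]_w ((f (jump mu a o x))%:E * (\1_W w)%:E))%E.
    apply: ae_eq_integral => //.
    - exact: (measurableT_comp mg (@measurable_pair1 _ _ (borel (config R)) Omega x)).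
    - by apply: emeasurable_funM => //; apply/measurable_EFinP; exact: measurable_indic.
    apply: filterS (flow_on_window x) => w Hw _; rewrite /g/= -EFinM; congr EFin.
    have [Ww|nW] := pselect (W w); first by rewrite (Hw 1 o).
    by rewrite indicE memNset// !mulr0.
  rewrite ge0_integralZl_EFin//; last by case/andP: (f01 (jump mu a o x)).
    rewrite integral_indic// setIT mulrC EFinM; congr (_ * _)%E.
    exact: (prob_window_event a noise).
  by apply/measurable_EFinP; exact: measurable_indic.
have p0 : window_prob 1 o != 0.
  rewrite gt_eqF// /window_prob; case: o {W mW g mg g0 gE} => [_|] /=; last by rewrite exprn_gt0 ?expR_gt0.
  by rewrite !mulr_gt0// ?exprn_gt0 ?expR_gt0// subr_gt0 expR_lt1 oppr_lt0.
have := @measurable_fun_fubini_tonelli_F _ _ _ _ _ P g mg g0.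
rewrite (_ : fubini_F P g = EFin \o (fun x => window_prob 1 o * f (jump mu a o x))); last first.
  by apply/funext => x; rewrite gE.
move/measurable_EFinP => H.
rewrite (_ : (fun x => _) = (fun x => (window_prob 1 o)^-1 * (window_prob 1 o * f (jump mu a o x)))).
  by apply: measurable_funM => //; exact: measurable_cst.
by apply/funext => x; rewrite mulKf.
Qed.

End flow_expectation.

Lemma big_option (R : Type) (idx : R) (op : Monoid.com_law idx) (I : finType)
    (F : option I -> R) :
  \big[op/idx]_o F o = op (F None) (\big[op/idx]_i F (Some i)).
Proof.
rewrite (bigD1 None)//=; congr (op _ _).
rewrite (reindex_omap Some id) => [|[]//]; apply: eq_bigl => i.
by rewrite eqxx.
Qed.

Section bounded_integrals.
Context d (T : measurableType d) (R : realType) (nu : probability T R).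
Implicit Types f g : T -> R.

Lemma integrable_bounded f (M : R) : measurable_fun setT f ->
  (forall x, `|f x| <= M) -> nu.-integrable setT (EFin \o f).
Proof.
move=> mf fM; apply: measurable_bounded_integrable => //.
  by rewrite (le_lt_trans (probability_le1 nu measurableT))// ltry.
by exists M; split; [exact: num_real|move=> r Mr x _; exact: le_trans (fM x) (ltW Mr)].
Qed.

Lemma integrable01 f : measurable_fun setT f -> (forall x, 0 <= f x <= 1) ->
  nu.-integrable setT (EFin \o f).
Proof.
move=> mf f01; apply: (@integrable_bounded f 1) => // x.
by case/andP: (f01 x) => f0 f1; rewrite ger0_norm.
Qed.

Lemma Rintegral_EFin f : nu.-integrable setT (EFin \o f) ->
  (\int[nu]_x (f x)%:E = (\int[nu]_x f x)%:E)%E.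
Proof. by move=> fi; rewrite /Rintegral fineK//; exact: integrable_fin_num. Qed.

Lemma Rintegral_cstT (r : R) : \int[nu]_x (cst r x) = r.
Proof. by rewrite Rintegral_cst// (_ : fine _ = 1) ?mulr1//; rewrite [X in fine X](@probability_setT _ _ _ nu). Qed.

Lemma Rintegral_sum (I : Type) (s : seq I) (f : I -> T -> R) :
  (forall i, nu.-integrable setT (EFin \o f i)) ->
  \int[nu]_x (\sum_(i <- s) f i x) = \sum_(i <- s) \int[nu]_x f i x.
Proof.
move=> fi; elim: s => [|i s IHs].
  rewrite big_nil; under eq_Rintegral do rewrite big_nil.
  exact: (Rintegral_cstT 0).
rewrite big_cons -IHs; under eq_Rintegral do rewrite big_cons.
rewrite RintegralD//.
rewrite (_ : EFin \o _ = (fun x => \sum_(i <- s) (EFin \o f i) x)%E).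
  exact: integrable_sum.
by apply/funext => x /=; rewrite sumEFin.
Qed.

Lemma Rintegral_ae_cst f (r : R) : measurable_fun setT f ->
  {ae nu, forall x, f x = r} -> \int[nu]_x f x = r.
Proof.
move=> mf fr; rewrite -[RHS](Rintegral_cstT r) /Rintegral; congr fine.
apply: ae_eq_integral => //; first exact/measurable_EFinP.
  by apply/measurable_EFinP; exact: measurable_cst.
by apply: filterS fr => x /= -> _.
Qed.

Lemma Rintegral_ae_le f (r : R) : nu.-integrable setT (EFin \o f) ->
  {ae nu, forall x, f x <= r} -> \int[nu]_x f x <= r.
Proof.
move=> fi fr; have ri : nu.-integrable setT (EFin \o cst r).
  exact: finite_measure_integrable_cst.
have hi : nu.-integrable setT (EFin \o (fun x => r - f x)).
  exact: (integrableB measurableT ri fi).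
rewrite -subr_ge0 -[X in X - _](Rintegral_cstT r) -RintegralB//.
have -> : \int[nu]_x (cst r x - f x) = \int[nu]_x `|r - f x|.
  rewrite /Rintegral; congr fine; apply: ae_eq_integral => //.
  - exact: measurable_int hi.
  - exact: measurable_int (integrable_abse hi).
  by apply: filterS fr => x fxr _ /=; rewrite ger0_norm// subr_ge0.
by apply: Rintegral_ge0 => x _.
Qed.

Lemma ae_eq_Rintegral_le f g : nu.-integrable setT (EFin \o f) ->
    nu.-integrable setT (EFin \o g) -> (forall x, f x <= g x) ->
  \int[nu]_x g x <= \int[nu]_x f x -> {ae nu, forall x, f x = g x}.
Proof.
move=> fi gi fg gf.
pose h x := g x - f x; have hi : nu.-integrable setT (EFin \o h).
  exact: (integrableB measurableT gi fi).
have h0 : \int[nu]_x h x = 0.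
  rewrite RintegralB//; apply/eqP; rewrite eq_le subr_le0 gf/= subr_ge0.
  exact: le_Rintegral.
have /(ae_eq_integral_abs nu measurableT (measurable_int _ hi)) : (\int[nu]_x `|(EFin \o h) x| = 0)%E.
  rewrite -[RHS]/(0%:E) -h0 -(Rintegral_EFin hi); apply: eq_integral => x _ /=.
  by rewrite ger0_norm// subr_ge0.
by apply: filterS => x /(_ I)/= [] /eqP; rewrite subr_eq0 => /eqP.
Qed.

End bounded_integrals.

Section stationarity.
Context {R : realType} (mu : R).
Context d (Omega : measurableType d) (P : probability Omega R).
Variables (tau : int -> nat -> {RV P >-> R}) (xi : int -> nat -> {RV P >-> bool}).
Variable eta : R -> {mfun (borel (config R) * Omega)%type >-> borel (config R)}.
Hypothesis noise : graphical_noise tau xi.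
Hypothesis flow : compass_flow tau xi mu eta.
Variable nu : probability (borel (config R)) R.
Hypothesis nu_inv : invariant_measure P eta nu.

Lemma invariant_integral t (f : borel (config R) -> \bar R) : 0 <= t ->
  measurable_fun setT f -> (forall x, 0 <= f x)%E ->
  (\int[nu]_x f x = \int[nu]_x \int[P]_w f (eta t (x, w)))%E.
Proof.
move=> t0 mf f0.
transitivity (\int[distribution (nu \x P)%E (eta t)]_x f x)%E.
  by apply: eq_measure_integral => A mA _; apply/esym; exact: nu_inv.
rewrite ge0_integral_distribution// (fubini_tonelli1 (f \o eta t))//.
  exact: (measurableT_comp mf (measurable_funPT (eta t))).
by move=> z; exact: f0.
Qed.

Variables (a : int) (n : nat) (f : config R -> R).
Hypothesis mf : measurable_fun setT (f : borel (config R) -> R).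
Hypothesis f01 : forall x, 0 <= f x <= 1.
Hypothesis flocal : window_local a n f.

Let integrable_jump (o : option ('I_n * bool)) :
  nu.-integrable setT (EFin \o (fun x : borel (config R) => f (jump mu a o x))).
Proof.
apply: integrable01; first exact: (measurable_jump noise flow mf f01 flocal).
by move=> x; exact: f01.
Qed.

(** What is learnt about an invariant [nu] passes through this bound: small [t] gives
    [generator_le], and [t = 1] gives [ae_interact]. *)
Lemma invariant_expect_le t : 0 < t ->
  \int[nu]_x f x <=
  1 - \sum_(o : option ('I_n * bool)) window_prob t o * (1 - \int[nu]_x f (jump mu a o x)).
Proof.
move=> t0.
pose g (x : borel (config R)) := 1 - \sum_(o : option ('I_n * bool)) window_prob t o * (1 - f (jump mu a o x)).
have c1i : nu.-integrable setT (EFin \o cst (1 : R)).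
  exact: finite_measure_integrable_cst.
have hi (o : option ('I_n * bool)) : nu.-integrable setT
    (EFin \o (fun x : borel (config R) => window_prob t o * (1 - f (jump mu a o x)))).
  have := integrableB measurableT c1i (integrable_jump o).
  exact: (integrableZl measurableT (window_prob t o)).
have si : nu.-integrable setT (EFin \o (fun x : borel (config R) =>
    \sum_(o : option ('I_n * bool)) window_prob t o * (1 - f (jump mu a o x)))).
  rewrite (_ : EFin \o _ = (fun x => \sum_(o : option ('I_n * bool))
     (window_prob t o * (1 - f (jump mu a o x)))%:E)%E).
    by apply: integrable_sum => // o _; exact: hi.
  by apply/funext => x /=; rewrite sumEFin.
have gi : nu.-integrable setT (EFin \o g) by exact: (integrableB measurableT c1i si).
have -> : 1 - \sum_(o : option ('I_n * bool)) window_prob t o * (1 - \int[nu]_x f (jump mu a o x)) =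
    \int[nu]_x g x.
  rewrite /g (RintegralB measurableT c1i si) Rintegral_cstT; congr (_ - _).
  rewrite (Rintegral_sum _ hi); apply: eq_bigr => o _.
  rewrite RintegralZl//; last exact: (integrableB measurableT c1i (integrable_jump o)).
  by rewrite (RintegralB measurableT c1i (integrable_jump o)) Rintegral_cstT.
rewrite -lee_fin -Rintegral_EFin//; last exact: integrable01.
rewrite -(Rintegral_EFin gi) (invariant_integral (ltW t0)); last 2 first.
- exact/measurable_EFinP.
- by move=> x; rewrite lee_fin; case/andP: (f01 x).
apply: ge0_le_integral => //.
- by move=> x _; apply: integral_ge0 => w _; rewrite lee_fin; case/andP: (f01 (eta t (x, w))).
- have mF := measurableT_comp mf (measurable_funPT (eta t)).
  apply: (@measurable_fun_fubini_tonelli_F _ _ _ _ _ P (EFin \o (f \o eta t))).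
    exact/measurable_EFinP.
  by move=> z; rewrite lee_fin; case/andP: (f01 (eta t z)).
- exact: measurable_int gi.
by move=> x _; exact: (expect_flow_le noise flow mf f01 flocal).
Qed.

End stationarity.

(** * Consequences of invariance for local functions *)

Lemma bernoulli_exp (R : realDomainType) (q : R) n : 0 <= q <= 1 ->
  1 - q ^+ n <= n%:R * (1 - q).
Proof.
move=> /andP[q0 q1]; elim: n => [|n IHn]; first by rewrite expr0 subrr mul0r.
have -> : 1 - q ^+ n.+1 = (1 - q ^+ n) + q ^+ n * (1 - q) by rewrite exprS; ring.
rewrite -natr1 mulrDl mul1r lerD// ler_piMl ?subr_ge0//.
exact: exprn_ile1.
Qed.

(** By convexity a positive increment persists to the right, so the function would grow linearly and
    leave [0, 1]. *)
Lemma convex_bounded_cst (R : archiRealFieldType) (h : int -> R) :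
  (forall e, 0 <= h e <= 1) -> (forall e, 2 * h e <= h (e - 1) + h (e + 1)) ->
  forall e, h e = h 0.
Proof.
move=> h01 hconv.
have step (g : int -> R) : (forall e, 0 <= g e <= 1) ->
    (forall e, 2 * g e <= g (e - 1) + g (e + 1)) -> forall e, g (e + 1) <= g e.
  move=> g01 gconv e; rewrite leNgt; apply/negP => ge.
  have incr (k : nat) : g (e + 1) - g e <= g (e + k%:Z + 1) - g (e + k%:Z).
    elim: k => [|k IHk]; first by rewrite addr0.
    apply: (le_trans IHk); have := gconv (e + k%:Z + 1).
    by rewrite addrK (_ : e + k.+1%:Z = e + k%:Z + 1); [lra|lia].
  have growth (k : nat) : k%:R * (g (e + 1) - g e) <= g (e + k%:Z) - g e.
    elim: k => [|k IHk]; first by rewrite mul0r addr0 subrr.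
    have := incr k; have -> : e + k.+1%:Z = e + k%:Z + 1 by lia.
    by rewrite -natr1 mulrDl mul1r; lra.
  have d0 : 0 < g (e + 1) - g e by rewrite subr_gt0.
  (* After more than 1 / (g (e + 1) - g e) steps the total growth exceeds 1. *)
  have := growth (Num.truncn ((g (e + 1) - g e)^-1)).+1.
  have := truncnS_gt ((g (e + 1) - g e)^-1).
  rewrite -(ltr_pM2r d0) mulVf ?gt_eqF// => h1 h2.
  by have := g01 e; have := g01 (e + (Num.truncn ((g (e + 1) - g e)^-1)).+1%:Z); lra.
have hS e : h (e + 1) = h e.
  apply/eqP; rewrite eq_le step//=.
  (* The reflection of Z gives the reverse inequality. *)
  have := step (fun e => h (- e)) (fun e => h01 (- e)) _ (- e - 1).
  rewrite subrK opprK opprB opprK [1 + e]addrC; apply => k.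
  by have := hconv (- k); rewrite opprB opprD [1 - k]addrC [h (- k - 1) + _]addrC.
move=> e; case: e => k; elim: k => [|k IHk].
- by [].
- by rewrite -IHk -(hS k%:Z); congr h; lia.
- by rewrite -(hS (- 1)).
- by rewrite -IHk -(hS (Negz k.+1)); congr h; lia.
Qed.

Section generator.
Context {R : realType} (mu : R).
Context d (Omega : measurableType d) (P : probability Omega R).
Variables (tau : int -> nat -> {RV P >-> R}) (xi : int -> nat -> {RV P >-> bool}).
Variable eta : R -> {mfun (borel (config R) * Omega)%type >-> borel (config R)}.
Hypothesis noise : graphical_noise tau xi.
Hypothesis flow : compass_flow tau xi mu eta.
Variable nu : probability (borel (config R)) R.
Hypothesis nu_inv : invariant_measure P eta nu.

Section local_function.
Variables (a : int) (n : nat) (f : config R -> R).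
Hypothesis mf : measurable_fun setT (f : borel (config R) -> R).
Hypothesis f01 : forall x, 0 <= f x <= 1.
Hypothesis flocal : window_local a n f.

Let E (j : 'I_n) b := \int[nu]_x f (interact mu (a + (j : nat)%:Z) b x).

Lemma integrable_interact (j : 'I_n) b :
  nu.-integrable setT (EFin \o (fun x => f (interact mu (a + (j : nat)%:Z) b x))).
Proof.
apply: integrable01; first exact: (measurable_jump noise flow mf f01 flocal (Some (j, b))).
by move=> x; exact: f01.
Qed.

Lemma Rintegral01 (g : borel (config R) -> R) : measurable_fun setT g ->
  (forall x, 0 <= g x <= 1) -> 0 <= \int[nu]_x g x <= 1.
Proof.
move=> mg g01; rewrite Rintegral_ge0 => [|x _]; last by case/andP: (g01 x).
rewrite -[leRHS](Rintegral_cstT nu 1); apply: le_Rintegral => //.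
- exact: integrable01.
- exact: finite_measure_integrable_cst.
- by move=> x _; case/andP: (g01 x).
Qed.

Let E01 j b : 0 <= E j b <= 1.
Proof.
apply: Rintegral01; first exact: (measurable_jump noise flow mf f01 flocal (Some (j, b))).
by move=> x; exact: f01.
Qed.

Let sum_window t :
  \sum_(i : option ('I_n * bool)) window_prob t i * (1 - \int[nu]_x f (jump mu a i x)) =
  expR (- t) ^+ n * (1 - \int[nu]_x f x) +
  \sum_(j < n) \sum_(b : bool) (1 - expR (- t)) * expR (- t) ^+ n * (1 / 2) * (1 - E j b).
Proof.
by rewrite big_option pair_bigA; congr (_ + _); apply: eq_bigr => -[j b].
Qed.

(** With q = e^{-t}, [h] the mean of [f] and [S] the sum of the mean deficits after one interaction,
    invariance gives (1 - q) q^n S <= (1 - h) (1 - q^n) <= (1 - h) n (1 - q). Dividing by 1 - q and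
    letting [t] tend to 0 leaves S <= n (1 - h). *)
Lemma generator_le :
  n%:R * (\int[nu]_x f x) <= \sum_(j < n) (E j true + E j false) / 2.
Proof.
pose h := \int[nu]_x f x; pose S := \sum_(j < n) (1 - (E j true + E j false) / 2).
suff : S <= n%:R * (1 - h).
  by rewrite /S sumrB sumr_const card_ord -/h mulrBr mulr1; lra.
have h01 : 0 <= h <= 1 by exact: Rintegral01.
have S0 : 0 <= S by apply: sumr_ge0 => j _; have := E01 j true; have := E01 j false; lra.
have key t : 0 < t -> S * (1 - n%:R * t) <= n%:R * (1 - h).
  move=> t0; have := invariant_expect_le noise flow nu_inv mf f01 flocal t0.
  rewrite sum_window -/h.
  rewrite (eq_bigr (fun j => (1 - expR (- t)) * expR (- t) ^+ n *
      (1 - (E j true + E j false) / 2))) => [|j _]; last first.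
    by rewrite big_bool /=; field.
  rewrite -mulr_sumr -/S; set q := expR (- t) => H.
  have q0 : 0 < q by exact: expR_gt0.
  have q1 : q < 1 by rewrite expR_lt1 oppr_lt0.
  have q01 : 0 <= q <= 1 by rewrite !ltW.
  have bq := bernoulli_exp n q01.
  have Sq : q ^+ n * S <= n%:R * (1 - h).
    have : (1 - q) * (q ^+ n * S) <= (1 - q) * (n%:R * (1 - h)).
      apply: (@le_trans _ _ ((1 - h) * (1 - q ^+ n))); first lra.
      have -> : (1 - q) * (n%:R * (1 - h)) = (1 - h) * (n%:R * (1 - q)) by ring.
      by apply: ler_wpM2l => //; lra.
    by rewrite ler_pM2l// subr_gt0.
  apply: le_trans Sq; rewrite mulrC; apply: ler_wpM2r => //.
  have qt : 1 - q <= t by have := expR_ge1Dx (- t); rewrite -/q; lra.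
  have nqt : n%:R * (1 - q) <= n%:R * t by exact: ler_wpM2l.
  by lra.
apply/ler_addgt0Pr => e e0.
have nS : 0 < n%:R * S + 1 by rewrite ltr_wpDl// mulr_ge0.
(* This [t] makes the error n S t at most [e]; the added 1 keeps the denominator positive when n S =
   0. *)
have := key (e / (n%:R * S + 1)); rewrite divr_gt0// => /(_ isT).
have : n%:R * S * (e / (n%:R * S + 1)) <= e.
  rewrite mulrCA ler_piMr ?(ltW e0)// ler_pdivrMr// mul1r; lra.
by lra.
Qed.

(** At [t = 1] each single ring has the same positive probability [p]. As [f] has mean 1, the
    weighted deficits sum to at most 0; being nonnegative, each vanishes. *)
Lemma ae_interact (j : 'I_n) b : {ae nu, forall x, f x = 1} ->
  {ae nu, forall x, f (interact mu (a + (j : nat)%:Z) b x) = 1}.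
Proof.
move=> f1.
have If : \int[nu]_x f x = 1 by exact: Rintegral_ae_cst.
have := invariant_expect_le noise flow nu_inv mf f01 flocal ltr01.
rewrite sum_window If subrr mulr0 add0r.
pose p : R := (1 - expR (- 1)) * expR (- 1) ^+ n * (1 / 2).
have p0 : 0 < p.
  by rewrite !mulr_gt0// ?exprn_gt0 ?expR_gt0// subr_gt0 expR_lt1 oppr_lt0.
rewrite -/p (bigD1 j)//= (bigD1 b)//=; set S1 := \sum_(_ | _ != b) _; set S2 := \sum_(_ | _ != j) _.
have pE0 i c : 0 <= p * (1 - E i c).
  by rewrite mulr_ge0 ?(ltW p0)// subr_ge0; case/andP: (E01 i c).
have S10 : 0 <= S1 by apply: sumr_ge0.
have S20 : 0 <= S2 by apply: sumr_ge0 => i _; apply: sumr_ge0.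
move=> H; have : p * (1 - E j b) <= 0 by lra.
rewrite pmulr_rle0// subr_le0 -[leLHS](Rintegral_cstT nu 1).
apply: ae_eq_Rintegral_le; first exact: integrable_interact.
  exact: finite_measure_integrable_cst.
by move=> x; case/andP: (f01 (interact mu (a + (j : nat)%:Z) b x)).
Qed.

End local_function.
End generator.

(** * Mean gaps under an invariant measure *)

Section stationary_gaps.
Context {R : realType} (mu : R).
Hypothesis mu01 : 0 < mu <= 1 / 2.
Context d (Omega : measurableType d) (P : probability Omega R).
Variables (tau : int -> nat -> {RV P >-> R}) (xi : int -> nat -> {RV P >-> bool}).
Variable eta : R -> {mfun (borel (config R) * Omega)%type >-> borel (config R)}.
Hypothesis noise : graphical_noise tau xi.
Hypothesis flow : compass_flow tau xi mu eta.
Variable nu : probability (borel (config R)) R.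
Hypothesis nu_inv : invariant_measure P eta nu.

Let h e := \int[nu]_x gap e x.
Let G e k b := \int[nu]_x gap e (interact mu k b x).

Lemma gap01 (e : int) (x : config R) : 0 <= gap e x <= 1.
Proof. by rewrite gap_ge0 gap_le1. Qed.

(** With five edges from [e - 2] on, the inner vertices of the window are exactly the ends [e] and
    [e + 1]. *)
Lemma window_local_gap e : window_local (e - 2) 5 (@gap R e).
Proof. by move=> x y xy; apply: gap_local; apply: xy; lia. Qed.

Lemma integrable_gap e : nu.-integrable setT (EFin \o gap e).
Proof. by apply: integrable01; [exact: measurable_gap|exact: gap01]. Qed.

Lemma integrable_gapD e k (r : R) :
  nu.-integrable setT (EFin \o (fun x => gap e x + r * gap k x)).
Proof.
have Zi := integrableZl measurableT r (integrable_gap k).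
exact: (integrableD measurableT (integrable_gap e) Zi).
Qed.

Lemma integral_gapD e k (r : R) :
  \int[nu]_x (gap e x + r * gap k x) = h e + r * h k.
Proof.
rewrite RintegralD//; first by rewrite RintegralZl//; exact: integrable_gap.
- exact: integrable_gap.
- exact: (integrableZl measurableT r (integrable_gap k)).
Qed.

Lemma integrable_gap_interact (e k : int) b : `|k - e| <= 2 ->
  nu.-integrable setT (EFin \o (fun x => gap e (interact mu k b x))).
Proof.
move=> ke; have jn : (absz (k - (e - 2)%R)%R < 5)%N by lia.
have -> : k = e - 2 + (Ordinal jn : nat)%:Z by rewrite /=; lia.
apply: (integrable_interact noise flow nu (@measurable_gap R e)).
  exact: gap01.
exact: window_local_gap.
Qed.

Lemma mean_gap_neighbour (e k : int) b : `|k - e| = 1 -> G e k b <= h e + mu * h k.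
Proof.
move=> ke; rewrite -integral_gapD; apply: le_Rintegral => //.
- by apply: integrable_gap_interact; lia.
- exact: integrable_gapD.
move=> x _; have [->|->] : k = e - 1 \/ k = e + 1 by lia.
  by have := gap_interact_next mu01 (e - 1) b x; rewrite subrK.
by have := gap_interact_prev mu01 (e + 1) b x; rewrite addrK.
Qed.

(** Of the five edges of the window, [e - 2] and [e + 2] leave the gap unchanged and [e] multiplies
    it by 1 - 2 mu; moving these three terms to the left turns 5 into 2 (1 + mu). *)
Lemma mean_gap_generator e :
  2 * (1 + mu) * h e <= (G e (e - 1) true + G e (e - 1) false) / 2 +
                        (G e (e + 1) true + G e (e + 1) false) / 2.
Proof.
have := generator_le noise flow nu_inv (@measurable_gap R e) (gap01 e) (@window_local_gap e).
pose F (k : int) := (G e k true + G e k false) / 2.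
rewrite -/(h e) -(big_mkord xpredT (fun j => F (e - 2 + j%:Z))).
have far b k : k = e - 2 \/ k = e + 2 -> G e k b = h e.
  by move=> ke; apply: eq_Rintegral => x _; rewrite gap_interact_far//; lia.
have same b : G e e b = (1 - 2 * mu) * h e.
  rewrite -RintegralZl//; last exact: integrable_gap.
  by apply: eq_Rintegral => x _; rewrite gap_interact_same.
rewrite /index_iota /= !big_cons big_nil.
have -> : e - 2 + 0%:Z = e - 2 by lia.
have -> : e - 2 + 1%:Z = e - 1 by lia.
have -> : e - 2 + 2%:Z = e by lia.
have -> : e - 2 + 3%:Z = e + 1 by lia.
have -> : e - 2 + 4%:Z = e + 2 by lia.
rewrite /F !(far _ (e - 2) (or_introl erefl)) !(far _ (e + 2) (or_intror erefl)) !same.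
move: (h e) (G e (e - 1) true) (G e (e - 1) false) (G e (e + 1) true)
  (G e (e + 1) false) => *; lra.
Qed.

Lemma mean_gap_convex e : 2 * h e <= h (e - 1) + h (e + 1).
Proof.
have := mean_gap_generator e.
have N1 b : G e (e - 1) b <= h e + mu * h (e - 1) by apply: mean_gap_neighbour; lia.
have N2 b : G e (e + 1) b <= h e + mu * h (e + 1) by apply: mean_gap_neighbour; lia.
move: (N1 true) (N1 false) (N2 true) (N2 false) => {N1 N2}.
move: (h e) (h (e - 1)) (h (e + 1)) (G e (e - 1) true) (G e (e - 1) false)
  (G e (e + 1) true) (G e (e + 1) false) => a b c *.
by case/andP: mu01 => mu0 _; rewrite -(ler_pM2l mu0); lra.
Qed.

Lemma mean_gap_cst e : h e = h 0.
Proof.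
apply: (@convex_bounded_cst R h _ mean_gap_convex) => {}e.
by apply: Rintegral01; [exact: measurable_gap|exact: gap01].
Qed.

Definition additive_gaps (x : config R) : Prop := forall e k : int, `|k - e| = 1 ->
  gap e (interact mu k true x) = gap e x + mu * gap k x.

(** Once [h] is constant, each of the four neighbour means in [mean_gap_generator] is at most (1 +
    mu) h while their sum is at least four times that. All four bounds are thus equalities, and a
    pointwise inequality with equal integrals is an almost sure equality. *)
Lemma ae_additive_gaps : {ae nu, forall x, additive_gaps x}.
Proof.
suff H : forall i : int * int, {ae nu, forall x : borel (config R), `|i.2 - i.1| = 1 ->
    gap i.1 (interact mu i.2 true x) = gap i.1 x + mu * gap i.2 x}.
  by apply: ae_imp (ae_forall_countable H) => x Hx e k; exact: (Hx (e, k)).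
move=> [e k]/=; have [ke|ke] := eqVneq `|k - e| 1; last first.
  by apply: aeW => x /eqP; rewrite (negPf ke).
suff : {ae nu, forall x : borel (config R),
    gap e (interact mu k true x) = gap e x + mu * gap k x}.
  by apply: ae_imp => x ->.
apply: ae_eq_Rintegral_le.
- by apply: integrable_gap_interact; lia.
- exact: integrable_gapD.
- move=> x; have [->|->] : k = e - 1 \/ k = e + 1 by lia.
    by have := gap_interact_next mu01 (e - 1) true x; rewrite subrK.
  by have := gap_interact_prev mu01 (e + 1) true x; rewrite addrK.
rewrite integral_gapD.
have := mean_gap_generator e.
have N1 b : G e (e - 1) b <= h e + mu * h (e - 1) by apply: mean_gap_neighbour; lia.
have N2 b : G e (e + 1) b <= h e + mu * h (e + 1) by apply: mean_gap_neighbour; lia.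
have := N1 true; have := N1 false; have := N2 true; have := N2 false.
rewrite !(mean_gap_cst (e + 1)) !(mean_gap_cst (e - 1)) (mean_gap_cst k) !(mean_gap_cst e).
have [->|->] : k = e - 1 \/ k = e + 1 by lia.
  rewrite -/(G e (e - 1) true).
  move: (h 0) (G e (e - 1) true) (G e (e - 1) false) (G e (e + 1) true)
    (G e (e + 1) false) => *; lra.
rewrite -/(G e (e + 1) true).
move: (h 0) (G e (e - 1) true) (G e (e - 1) false) (G e (e + 1) true)
  (G e (e + 1) false) => *; lra.
Qed.

End stationary_gaps.

(** * Weights on edges: smoothing steps and total mass *)

Section mass_concentration.
Context {R : realType} (mu : R).
Hypothesis mu0 : 0 < mu.
Implicit Types (w : nat -> R) (i k M : nat).

(** Centred at [i.+1], so that no index drops below 0; [smooth i] acts at [i.+1] accordingly. *)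
Definition laplacian w i : R := w i - 2 * w i.+1 + w i.+2.

Definition smooth i w k : R := if k == i.+1 then w k + mu * laplacian w i else w k.

(* Green's identity against the Green function k (M + 1 - k) / 2 of the
   Laplacian on {1, ..., M}. *)
Lemma sum_green w M : w 0%N = 1 -> w M.+1 = 0 ->
  \sum_(i < M) w i.+1 = M%:R / 2 -
    \sum_(i < M) (i.+1%:R * (M%:R - i%:R) / 2) * laplacian w i.
Proof.
move=> w0 wM; pose G k : R := k%:R * (M.+1%:R - k%:R) / 2.
(* A discrete Wronskian: as [G] has Laplacian -1, its increment at [i] is - w (i + 1) - G (i + 1) *
   laplacian w i. *)
pose f k := w k * G k.+1 - G k * w k.+1.
have fM : \sum_(i < M) (f i.+1 - f i) = - (M%:R / 2).
  rewrite -(big_mkord xpredT (fun i => f i.+1 - f i)) telescope_sumr//.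
  by rewrite /f wM w0 /G subrr -[M.+1%:R]natr1; lra.
have -> : M%:R / 2 = - \sum_(i < M) (f i.+1 - f i) by rewrite fM opprK.
rewrite -sumrN -sumrB; apply: eq_bigr => i _; rewrite /f /G /laplacian.
by rewrite -!natr1; field.
Qed.

(** Take [w] in the class with mass within [e] of the supremum. Smoothing at [i] stays in the class
    and adds [mu * laplacian w i] to the mass, so every Laplacian is at most [e / mu], and
    [sum_green] bounds the mass below by M / 2 up to a multiple of [e]. *)
Lemma half_le_mass M (W : (nat -> R) -> Prop) (B : R) :
    (exists w, W w) -> (forall w, W w -> w 0%N = 1 /\ w M.+1 = 0) ->
    (forall w i, (i < M)%N -> W w -> W (smooth i w)) ->
    (forall w, W w -> \sum_(i < M) w i.+1 <= B) ->
  M%:R / 2 <= B.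
Proof.
move=> [w1 Ww1] Wbd Wstep WB.
pose mass w := \sum_(i < M) w i.+1; pose A := [set mass w | w in W].
have supA : has_sup A.
  by split; [exists (mass w1), w1|exists B => _ [w Ww <-]; exact: WB].
have SB : sup A <= B by apply: ge_sup => [|_ [w Ww <-]]; [exists (mass w1), w1|exact: WB].
pose C := \sum_(i < M) (i.+1%:R * (M%:R - i%:R) / 2 : R).
have C0 : 0 <= C.
  apply: sumr_ge0 => i _; rewrite divr_ge0// mulr_ge0// subr_ge0 ler_nat.
  exact: ltnW.
have key e : 0 < e -> M%:R / 2 - e / mu * C <= sup A.
  move=> e0; have [_ [w Ww <-] we] := sup_adherent e0 supA.
  have [w0 wM] := Wbd w Ww.
  have lapE i : (i < M)%N -> laplacian w i <= e / mu.
    move=> iM; rewrite ler_pdivlMr// mulrC.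
    have : mass (smooth i w) <= sup A.
      by apply: sup_upper_bound => //; exists (smooth i w) => //; exact: Wstep.
    have -> : mass (smooth i w) = mass w + mu * laplacian w i.
      rewrite /mass [in RHS](bigD1 (Ordinal iM))//= [in LHS](bigD1 (Ordinal iM))//=.
      rewrite {1}/smooth eqxx [RHS]addrAC; congr (_ + _); apply: eq_bigr => j ji.
      by rewrite /smooth eqSS ifF//; apply/negbTE.
    by lra.
  have wA : mass w <= sup A by apply: sup_upper_bound => //; exists w.
  apply: le_trans wA; rewrite /mass (sum_green w0 wM) lerD2l lerN2 mulr_sumr.
  apply: ler_sum => i _; rewrite mulrC; apply: ler_wpM2r; last exact: lapE.
  by rewrite divr_ge0// mulr_ge0// subr_ge0 ler_nat ltnW.
apply: le_trans SB; apply/ler_addgt0Pr => e e0.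
have C1 : 0 < C + 1 by rewrite ltr_wpDl.
(* Scaled so that the error term becomes e C / (C + 1) <= e. *)
have := key (mu * (e / (C + 1))); rewrite !mulr_gt0 ?invr_gt0// => /(_ isT).
rewrite [mu * _]mulrC mulfK ?gt_eqF//.
have : e / (C + 1) * C <= e by rewrite mulrAC ler_pdivrMr// ler_wpM2l ?(ltW e0)//; lra.
by lra.
Qed.

Lemma sum_delta (F : nat -> R) (N j : nat) :
  \sum_(k < N) F k * (k == j :> nat)%:R = if (j < N)%N then F j else 0.
Proof.
case: ifP => [jN|jN].
  rewrite (bigD1 (Ordinal jN))//= eqxx mulr1 big1 ?addr0// => k kj.
  by rewrite (_ : (k == j :> nat) = false) ?mulr0//; apply/negbTE.
rewrite big1// => k _; rewrite (_ : (k == j :> nat) = false) ?mulr0//.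
by apply/negbTE; apply: contraFN jN => /eqP <-.
Qed.

End mass_concentration.

(** * Vanishing of the stationary gaps *)

Section no_gaps.
Context {R : realType} (mu : R).
Hypothesis mu01 : 0 < mu <= 1 / 2.
Context d (Omega : measurableType d) (P : probability Omega R).
Variables (tau : int -> nat -> {RV P >-> R}) (xi : int -> nat -> {RV P >-> bool}).
Variable eta : R -> {mfun (borel (config R) * Omega)%type >-> borel (config R)}.
Hypothesis noise : graphical_noise tau xi.
Hypothesis flow : compass_flow tau xi mu eta.
Variable nu : probability (borel (config R)) R.
Hypothesis nu_inv : invariant_measure P eta nu.

Definition weighted_gaps (M : nat) (w : nat -> R) (x : config R) : R :=
  \sum_(k < M.+1) w k * gap k%:Z x.

Lemma measurable_weighted_gaps M w :
  measurable_fun setT (weighted_gaps M w : borel (config R) -> R).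
Proof.
apply: measurable_sum => k; apply: measurable_funM; first exact: measurable_cst.
exact: measurable_gap.
Qed.

(** By additivity the interaction at edge [i.+1] adds mu times its gap times (1, -2, 1) to the gaps
    at [i], [i.+1], [i.+2]. Transposed onto the weights, this changes only the weight at [i.+1], by
    [mu * laplacian w i]. *)
Lemma weighted_gaps_smooth M w i x : w M.+1 = 0 -> (i < M)%N ->
    additive_gaps mu x ->
  weighted_gaps M w (interact mu i.+1%:Z true x) = weighted_gaps M (smooth mu i w) x.
Proof.
move=> wM iM addx; pose g := gap i.+1%:Z x.
have gapE k : gap k%:Z (interact mu i.+1%:Z true x) = gap k%:Z x +
    mu * g * ((k == i)%:R + (k == i.+2)%:R - 2 * (k == i.+1)%:R).
  have [->|ki] := eqVneq k i.
    rewrite addx -/g; last by lia.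
    have [-> ->] : (i == i.+2) = false /\ (i == i.+1) = false by lia.
    by rewrite /=; ring.
  have [->|ki2] := eqVneq k i.+2.
    rewrite addx -/g; last by lia.
    have -> : (i.+2 == i.+1) = false by lia.
    by rewrite /=; ring.
  have [->|ki1] := eqVneq k i.+1.
    by rewrite gap_interact_same// -/g /=; ring.
  by rewrite gap_interact_far; [rewrite /=; ring|lia..].
rewrite /weighted_gaps.
under eq_bigr do rewrite gapE.
have -> : \sum_(k < M.+1) w k * (gap k%:Z x + mu * g *
    ((k == i :> nat)%:R + (k == i.+2 :> nat)%:R - 2 * (k == i.+1 :> nat)%:R)) =
  \sum_(k < M.+1) w k * gap k%:Z x + mu * g *
   (\sum_(k < M.+1) w k * (k == i :> nat)%:R + \sum_(k < M.+1) w k * (k == i.+2 :> nat)%:R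
    - 2 * \sum_(k < M.+1) w k * (k == i.+1 :> nat)%:R).
  rewrite !mulr_sumr -big_split/= -sumrB mulr_sumr -big_split/=.
  by apply: eq_bigr => k _; ring.
have -> : \sum_(k < M.+1) smooth mu i w k * gap k%:Z x =
    \sum_(k < M.+1) w k * gap k%:Z x +
    \sum_(k < M.+1) mu * laplacian w i * gap k%:Z x * (k == i.+1 :> nat)%:R.
  rewrite -big_split/=; apply: eq_bigr => k _; rewrite /smooth.
  by case: eqP => _; rewrite ?mulr1 ?mulr0; ring.
rewrite (sum_delta (fun k => mu * laplacian w i * gap k%:Z x)) !sum_delta.
rewrite (leqW iM) !ltnS iM -/g /laplacian.
(* If [i.+2] is [M.+1], that gap is outside the sum, and [w M.+1 = 0] makes the Laplacian agree. *)
have [i1M|Mi] := leqP i.+2 M; first by ring.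
by have -> : w i.+2 = 0; [rewrite -wM; congr w; lia|ring].
Qed.

Definition feasible (M : nat) (w : nat -> R) : Prop :=
  [/\ w 0%N = 1, w M.+1 = 0 &
      {ae nu, forall x : borel (config R), weighted_gaps M w x <= 1}].

Lemma feasible_smooth M w i : (i < M)%N -> feasible M w -> feasible M (smooth mu i w).
Proof.
move=> iM [w0 wM wae]; split=> //.
  by rewrite /smooth ifF//; apply/negbTE; lia.
pose f (x : borel (config R)) : R := \1_[set x : borel (config R) | weighted_gaps M w x <= 1] x.
have f1 x : f x = 1 <-> weighted_gaps M w x <= 1.
  rewrite /f indicE; split=> [|H]; last by rewrite mem_set.
  by case: (boolP (_ \in _)) => [/set_mem//|_ /eqP]; rewrite eq_sym oner_eq0.
have mf : measurable_fun setT f.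
  apply: measurable_indic; rewrite -[X in measurable X]setTI.
  have := measurable_weighted_gaps M w measurableT (measurable_itv `]-oo, 1]).
  by rewrite set_itvE.
have f01 (x : config R) : 0 <= f x <= 1 by rewrite /f indicE ler0n lern1 leq_b1.
(* The inner vertices are 0, ..., M + 1, the ends of the edges 0, ..., M; edge [i.+1] has index
   [i + 3] in this window. *)
have floc : window_local (-2) (M + 5) f.
  move=> x y xy; rewrite /f !indicE; congr (nat_of_bool _)%:R; apply/idP/idP;
    rewrite !inE /= /weighted_gaps => H; apply: le_trans H; rewrite le_eqVlt;
    apply/orP; left; apply/eqP; apply: eq_bigr => k _; congr (_ * _);
    have kM := ltn_ord k; apply: gap_local; [symmetry|symmetry| |]; apply: xy; lia.
have jM : (i + 3 < M + 5)%N by lia.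
have ei : -2 + (Ordinal jM : nat)%:Z = i.+1%:Z by rewrite /=; lia.
have fae : {ae nu, forall x : borel (config R), f x = 1}.
  by apply: ae_imp wae => x; rewrite f1.
have := ae_interact noise flow nu_inv mf f01 floc (Ordinal jM) true fae.
rewrite ei => /ae_and /(_ (ae_additive_gaps mu01 noise flow nu_inv)).
by apply: ae_imp => x [/f1 H addx]; rewrite -weighted_gaps_smooth.
Qed.

Lemma feasible_mass M w : feasible M w ->
  (\sum_(k < M.+1) w k) * (\int[nu]_x gap 0 x) <= 1.
Proof.
move=> [_ _ wae]; have gi k := integrable_gap nu k.
have wgi (k : 'I_M.+1) : nu.-integrable setT (EFin \o (fun x => w k * gap k%:Z x)).
  exact: (integrableZl measurableT (w k) (gi k%:Z)).
have -> : (\sum_(k < M.+1) w k) * (\int[nu]_x gap 0 x) = \int[nu]_x weighted_gaps M w x.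
  rewrite (Rintegral_sum _ wgi) mulr_suml; apply: eq_bigr => k _.
  by rewrite RintegralZl// (mean_gap_cst mu01 noise flow nu_inv k%:Z).
apply: Rintegral_ae_le wae.
rewrite (_ : EFin \o _ = (fun x => \sum_(k < M.+1) (w k * gap k%:Z x)%:E)%E).
  by apply: integrable_sum => // k _; exact: wgi.
by apply/funext => x /=; rewrite /weighted_gaps sumEFin.
Qed.

Lemma stationary_gap0 : {ae nu, forall x : config R, forall e, gap e x = 0}.
Proof.
pose c := \int[nu]_x gap 0 x.
have c0 : c = 0.
  apply/eqP; rewrite eq_le Rintegral_ge0 ?andbT => [|x _]; last exact: gap_ge0.
  rewrite leNgt; apply/negP => c0.
  have H M : M%:R / 2 <= c^-1.
    apply: (@half_le_mass _ mu _ M (feasible M)).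
    - by case/andP: mu01.
    (* The starting weights: the single gap at edge 0, at most 1 everywhere. *)
    - exists (fun k => (k == 0%N)%:R); split=> //.
      apply: aeW => x; rewrite /weighted_gaps.
      under eq_bigr do rewrite mulrC.
      by rewrite (sum_delta (fun k => gap k%:Z x)) gap_le1.
    - by move=> w [].
    - by move=> w i; exact: feasible_smooth.
    - move=> w fw; rewrite -[leRHS]mul1r ler_pdivlMr//.
      apply: le_trans (feasible_mass fw); rewrite -/c ler_pM2r// big_ord_recl lerDr.
      by case: fw => ->.
  have := H (2 * (Num.truncn c^-1).+1)%N.
  by rewrite natrM mulrAC divff ?mul1r// leNgt truncnS_gt.
apply: ae_forall_countable => e.
have := @ae_eq_Rintegral_le _ _ _ nu (cst 0) (gap e) (finite_measure_integrable_cst _ _ measurableT)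
  (integrable_gap nu e) (gap_ge0 e).
rewrite (mean_gap_cst mu01 noise flow nu_inv e) -/c c0 Rintegral_ge0// => /(_ isT).
by apply: ae_imp => x /= <-.
Qed.

End no_gaps.

(** * Mixtures of consensus measures *)

Section consensus_measures.
Context {R : realType}.
Variable nu : probability (borel (config R)) R.

Lemma gap0_consensus (x : config R) : (forall e, gap e x = 0) -> x = consensus (x 0).
Proof.
move=> x0; have xS e : x e = x (e + 1) by apply/eqP; rewrite -gap_eq0 x0.
apply/funext => v; rewrite /consensus; case: v => k; elim: k => [|k IHk].
- by [].
- by rewrite -IHk (xS k%:Z); congr x; lia.
- by rewrite (xS (Negz 0)).
- by rewrite -IHk (xS (Negz k.+1)); congr x; lia.
Qed.

Lemma gap_consensus e (s : opinion R) : gap e (consensus s) = 0.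
Proof. by apply/eqP; rewrite gap_eq0. Qed.

Lemma measurable_gap_neq0 e : measurable [set x : borel (config R) | gap e x != 0].
Proof.
rewrite (_ : [set _ | _] = gap e @^-1` [set~ 0]); last first.
  by apply/seteqP; split=> x /= /eqP.
rewrite -[X in measurable X]setTI; apply: (measurable_gap e measurableT).
by apply: measurableC; exact: measurable_set1.
Qed.

Lemma ae_gap0P :
  {ae nu, forall x : config R, forall e, gap e x = 0} <->
  forall e, nu [set x : borel (config R) | gap e x != 0] = 0%E.
Proof.
split=> [H e|H].
  apply/negligibleP; first exact: measurable_gap_neq0.
  apply: negligibleS H => x /= /eqP gx Hx; apply: gx.
  exact: (Hx e).
apply: ae_forall_countable => e; exists [set x : borel (config R) | gap e x != 0].
split=> [| |x /= /eqP//]; [exact: measurable_gap_neq0|exact: H].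
Qed.

End consensus_measures.

Section consensus_mixtures.
Context {R : realType}.
Variable nu : probability (borel (config R)) R.

Lemma eq_measure_ae (A B : set (borel (config R))) : measurable A -> measurable B ->
  {ae nu, forall x, A x <-> B x} -> nu A = nu B.
Proof.
move=> mA mB AB; have ind (C : set (borel (config R))) : measurable C ->
    nu C = (\int[nu]_x (\1_C x)%:E)%E by move=> mC; rewrite integral_indic// setIT.
rewrite (ind A mA) (ind B mB); apply: ae_eq_integral => //.
- by apply/measurable_EFinP; exact: measurable_indic.
- by apply/measurable_EFinP; exact: measurable_indic.
apply: ae_imp AB => x ABx _; rewrite !indicE; congr ((nat_of_bool _)%:R)%:E.
by apply/idP/idP; rewrite !inE => /ABx.
Qed.

Lemma measurable_eval (v : int) : measurable_fun setT
  (fun x : borel (config R) => (x : config R) v : borel (opinion R)).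
Proof. exact: (@borel_measurable_fun (config R) (opinion R) _ (@eval_continuous R v)). Qed.

Lemma measurable_consensus :
  measurable_fun setT (@consensus R : borel (opinion R) -> borel (config R)).
Proof. exact: (@borel_measurable_fun (opinion R) (config R) _ (@consensus_continuous R)). Qed.

Lemma consensus_dirac_integral (rho : probability (borel (opinion R)) R) A :
  measurable A ->
  (\int[rho]_s consensus_dirac s A = rho (@consensus R @^-1` A))%E.
Proof.
move=> mA; have mcA : measurable (@consensus R @^-1` A : set (borel (opinion R))).
  by rewrite -[X in measurable X]setTI; exact: measurable_consensus.
by rewrite -[in RHS](setIT (_ @^-1` _)) -integral_indic.
Qed.

(** The mixing measure is the law of the opinion at vertex 0, which almost surely determines the
    configuration. *)
Lemma ae_gap0_mixture : {ae nu, forall x : config R, forall e, gap e x = 0} ->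
  exists rho : probability (borel (opinion R)) R, consensus_mixture rho nu.
Proof.
move=> nu0.
pose X : {mfun borel (config R) >-> borel (opinion R)} := mfun_Sub (mem_set (measurable_eval 0)).
exists (distribution nu X) => A mA.
rewrite consensus_dirac_integral// /distribution /pushforward.
apply: eq_measure_ae => //.
  rewrite -[X in measurable X]setTI.
  exact: (measurableT_comp measurable_consensus (measurable_eval 0)).
by apply: ae_imp nu0 => x /gap0_consensus {1}->.
Qed.

Lemma mixture_ae_gap0 (rho : probability (borel (opinion R)) R) :
  consensus_mixture rho nu -> {ae nu, forall x : config R, forall e, gap e x = 0}.
Proof.
move=> mix; apply/ae_gap0P => e; rewrite mix; last exact: measurable_gap_neq0.
rewrite integral0_eq// => s _; rewrite /consensus_dirac/= diracE memNset//=.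
by rewrite gap_consensus eqxx.
Qed.

End consensus_mixtures.

(** * Invariance of the consensus mixtures *)

Section consensus_invariance.
Context {R : realType} (mu : R).
Context d (Omega : measurableType d) (P : probability Omega R).
Variables (tau : int -> nat -> {RV P >-> R}) (xi : int -> nat -> {RV P >-> bool}).
Variable eta : R -> {mfun (borel (config R) * Omega)%type >-> borel (config R)}.
Hypothesis noise : graphical_noise tau xi.
Hypothesis flow : compass_flow tau xi mu eta.

Lemma quiet_edges_ae t : 0 < t -> {ae P, forall w, forall v : int,
  (exists k : nat, t < tau (v - 1 - k%:Z) 0 w) /\ (exists k : nat, t < tau (v + k%:Z) 0 w)}.
Proof.
move=> t0; apply: ae_forall_countable => v.
apply: ae_and.
  apply: (@tau_gt_ae R _ _ _ _ _ noise (fun k => (v - 1 - k%:Z, 0%N)) t _ t0).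
  by move=> k l [/eqP]; lia.
apply: (@tau_gt_ae R _ _ _ _ _ noise (fun k => (v + k%:Z, 0%N)) t _ t0).
by move=> k l [/eqP]; lia.
Qed.

Lemma long_waits_ae : {ae P, forall w, forall i : int * nat,
  exists k, 1 < tau i.1 (i.2 + k) w}.
Proof.
apply: ae_forall_countable => -[e m].
apply: (@tau_gt_ae R _ _ _ _ _ noise (fun k => (e, (m + k)%N)) 1 _ ltr01).
by move=> k l [/eqP]; lia.
Qed.

(** The silent edges on both sides of [v] depend on the noise but enclose a finite block, in which
    each edge has finitely many rings up to [t]; [consensus_block] then applies. *)
Lemma flow_consensus (s : opinion R) t : 0 <= t ->
  {ae P, forall w, eta t (consensus s, w) = consensus s :> config R}.
Proof.
move=> t0; have [->|t_neq0] := eqVneq t 0.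
  by apply: ae_imp (flow (consensus s)) => w /trajectory_start.
have {t_neq0}tgt0 : 0 < t by rewrite lt_neqAle eq_sym t_neq0.
have := ae_and (ae_and (flow (consensus s)) (tau_gt0_ae noise))
  (ae_and (quiet_edges_ae tgt0) long_waits_ae).
apply: ae_imp => w [[traj tau0] [qe lw]]; apply/funext => v.
have [[k ak] [l bl]] := qe v.
have /choice[Nf HN] : forall i : nat, exists N, forall n, (N <= n)%N ->
    t < ring_time tau w (v - 1 - k%:Z + i%:Z) n.
  by move=> i; apply: ring_time_diverges => // m; exact: (lw (_, m)).
(* The block has [k + l + 2] edges, from [v - 1 - k] to [v + l]; the maximum makes the ring bound
   uniform over them. *)
apply: (@consensus_block R mu _ _ s _ traj (v - 1 - k%:Z) (v + l%:Z) t
  (\max_(i < (k + l).+2) Nf i)).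
- by lia.
- exact: quiet_first.
- exact: quiet_first.
- move=> e n eab Nn; have ei : (absz (e - (v - 1 - k%:Z)%R)%R < (k + l).+2)%N by lia.
  have := HN (Ordinal ei) n (leq_trans (leq_bigmax (Ordinal ei)) Nn).
  by rewrite (_ : _ + _ = e)//=; lia.
- by rewrite t0 lexx.
- by lia.
Qed.

Lemma ae_gap0_invariant (nu : probability (borel (config R)) R) :
  {ae nu, forall x : config R, forall e, gap e x = 0} -> invariant_measure P eta nu.
Proof.
move=> nu0 t t0 A mA.
have m1 : measurable_fun setT (fun x : borel (config R) => (\1_A x : R)%:E).
  by apply/measurable_EFinP; exact: measurable_indic.
have mE : measurable (eta t @^-1` A).
  by rewrite -[X in measurable X]setTI; exact: (measurable_funPT (eta t)).
have mF : measurable_fun setT (fun z : borel (config R) * Omega => (\1_A (eta t z) : R)%:E).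
  exact: (measurableT_comp m1 (measurable_funPT (eta t))).
transitivity (\int[(nu \x P)%E]_z (\1_A (eta t z))%:E)%E.
  by rewrite [RHS](integral_indic _ measurableT mE) setIT.
rewrite (fubini_tonelli1 (fun z => (\1_A (eta t z))%:E))//.
transitivity (\int[nu]_x (\1_A x)%:E)%E; last by rewrite integral_indic// setIT.
apply: ae_eq_integral => //.
  by apply: (@measurable_fun_fubini_tonelli_F _ _ _ _ _ P (fun z => (\1_A (eta t z))%:E)).
apply: ae_imp nu0 => x /gap0_consensus xE _.
have -> : (\1_A x : R)%:E = (\int[P]_w (cst (\1_A x)%:E w))%E.
  rewrite integral_cst// -[LHS]mule1; congr (_ * _)%E.
  exact/esym/probability_setT.
apply: ae_eq_integral => //.
  exact: (measurableT_comp mF (@measurable_pair1 _ _ (borel (config R)) Omega x)).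
by rewrite xE; apply: ae_imp (flow_consensus (x 0) t0) => w /= -> _.
Qed.

End consensus_invariance.

(** * The weakly closed convex hull of the consensus measures *)

Lemma ptws_eval_continuous (I : Type) (V : topologicalType) (i : I) :
  continuous (fun f : {ptws I -> V} => f i).
Proof.
move=> f A; rewrite nbhsE => -[B [oB Bf] BA].
have /cvg_sup/(_ i) H : nbhs f --> f by exact: cvg_id.
apply: (H _); exists (@proj I (fun=> V) i @^-1` B); split=> //; first by exists B.
by move=> g; exact: BA.
Qed.

Lemma initial_cvg (S : choiceType) (T : topologicalType) (f : S -> T)
    (F : set_system S) (s : S) : Filter F ->
  f @ F --> f s -> F --> (s : initial_topology f).
Proof.
move=> FF fF A [B [[C oC <-] Cf] BA].
by apply: (filterS BA); apply: fF; exact: open_nbhs_nbhs.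
Qed.

Section convex_combinations.
Context d (T : measurableType d) {R : realType}.
Variables (m0 m1 : probability T R) (w : R) (w01 : 0 <= w <= 1).

Let w0 : 0 <= w. Proof. by case/andP: w01. Qed.
Let w1 : 0 <= 1 - w. Proof. by rewrite subr_ge0; case/andP: w01. Qed.

Definition prob_mix : set T -> \bar R :=
  measure_add (mscale (NngNum w0) m0) (mscale (NngNum w1) m1).

HB.instance Definition _ := Measure.on prob_mix.

Lemma prob_mixE A : prob_mix A = (w%:E * m0 A + (1 - w)%:E * m1 A)%E.
Proof. exact: (measure_addE (mscale (NngNum w0) m0) (mscale (NngNum w1) m1) A). Qed.

Let prob_mixT : prob_mix setT = 1%E.
Proof.
rewrite prob_mixE [m0 setT]probability_setT [m1 setT]probability_setT !mule1.
by rewrite -EFinD addrC subrK.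
Qed.

HB.instance Definition _ := Measure_isProbability.Build _ _ _ prob_mix prob_mixT.

End convex_combinations.

Section consensus_hull.
Context {R : realType}.
Notation prob := (probability (borel (config R)) R).

(** Convexity with weight 1 already absorbs a change of the values on non-measurable sets. *)
Lemma convex_measures_ext (C : set prob) (m m' : prob) : convex_measures C ->
  C m -> (forall A, measurable A -> m' A = m A) -> C m'.
Proof.
move=> Cc Cm mm'; apply: (Cc m m m' 1) => //; first by rewrite ler01 lexx.
by move=> A mA; rewrite subrr mul0e adde0 mul1e mm'.
Qed.

(** Split off the first atom, of mass [p], and rescale the others by 1 / (1 - p); the case [p = 1],
    where this is impossible, leaves the other atoms with mass 0. *)
Lemma finite_mixture (C : set prob) : convex_measures C ->
    range (@consensus_dirac R) `<=` C ->
  forall s : seq (R * opinion R), all (fun p => 0 <= p.1) s -> \sum_(p <- s) p.1 = 1 ->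
  exists2 m, C m & forall A, measurable A ->
    m A = (\sum_(p <- s) p.1%:E * consensus_dirac p.2 A)%E.
Proof.
move=> Cc CD s; have [n] := ubnP (size s); elim: n s => // n IHn [|[p o] s] /=.
  by rewrite big_nil => _ _ /eqP; rewrite eq_sym oner_eq0.
rewrite ltnS => sn /andP[p0 s0]; rewrite big_cons/= => ps1.
have Cdir : C (consensus_dirac o) by apply: CD; exists o.
have sum0 : 0 <= \sum_(q <- s) q.1.
  by rewrite big_seq; apply: sumr_ge0 => q /(allP s0).
have [p1|pN1] := eqVneq p 1.
  exists (consensus_dirac o) => // A mA; rewrite big_cons/= p1 mul1e.
  rewrite big_seq big1 ?adde0// => q qs.
  have : \sum_(q <- s) q.1 = 0 by lra.
  move=> /eqP; rewrite big_seq psumr_eq0 => [/allP/(_ q qs)|? /(allP s0)//].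
  by rewrite qs => /eqP ->; rewrite mul0e.
have q0 : 0 < 1 - p by rewrite subr_gt0 lt_neqAle pN1; lra.
pose s' := [seq (r.1 / (1 - p), r.2) | r <- s].
have [m' Cm' m'E] : exists2 m, C m & forall A, measurable A ->
    m A = (\sum_(q <- s') q.1%:E * consensus_dirac q.2 A)%E.
  apply: IHn; first by rewrite size_map.
    by rewrite all_map; apply: sub_all s0 => q /= ?; rewrite divr_ge0// ltW.
  rewrite big_map/= -mulr_suml (_ : \sum_(q <- s) q.1 = 1 - p); last by lra.
  by rewrite divff// gt_eqF.
have p01 : 0 <= p <= 1 by rewrite p0; lra.
exists (prob_mix (consensus_dirac o) m' p01).
  by apply: (Cc _ _ _ p Cdir Cm' p01) => A _; exact: prob_mixE.
move=> A mA; rewrite [LHS]prob_mixE m'E// big_cons big_map/=; congr (_ + _)%E.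
rewrite big_seq [RHS]big_seq ge0_sume_distrr => [|q qs]; last first.
  by rewrite mule_ge0// lee_fin divr_ge0 ?(ltW q0)//; exact: (allP s0).
by apply: eq_bigr => q qs; rewrite muleA -EFinM [(1 - p) * _]mulrC divfK// gt_eqF.
Qed.

End consensus_hull.

Section quantization.
Context {R : realType}.

(* [point] is a junk value, reached only if no point of [l] is close to [s]. *)
Fixpoint quantize (l : seq (opinion R)) (r : R) (s : opinion R) : opinion R :=
  if l is p :: l' then if circle_dist p s < r then p else quantize l' r s
  else point.

Lemma quantize_mem l r s : quantize l r s \in point :: l.
Proof.
elim: l => [|p l IHl] /=; first by rewrite inE.
case: ifP => _; first by rewrite !inE eqxx orbT.
by move: IHl; rewrite !inE => /orP[->//|->]; rewrite !orbT.
Qed.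

Lemma quantize_close l r s : has (fun p => circle_dist p s < r) l ->
  circle_dist (quantize l r s) s < r.
Proof. by elim: l => //= p l IHl; case: ifP. Qed.

Lemma measurable_circle_dist (p : opinion R) :
  measurable_fun setT (fun s : borel (opinion R) => circle_dist p s : R).
Proof.
apply: (@borel_measurable_realfun R (opinion R) (circle_dist p)).
by apply: (@circle_dist_continuous R (opinion R) (cst p) id);
  [exact: cst_continuous|move=> s; exact: cvg_id].
Qed.

Lemma measurable_quantize l r :
  measurable_fun setT (quantize l r : borel (opinion R) -> borel (opinion R)).
Proof.
elim: l => [|p l IHl] /=; first exact: measurable_cst.
apply: measurable_fun_ifT => //.
apply: measurable_fun_ltr; [exact: measurable_circle_dist|exact: measurable_cst].
Qed.

Lemma circle_dist_eq0 (p q : opinion R) : circle_dist p q = 0 <-> p = q.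
Proof.
split=> [|->]; last by rewrite circle_distE subrr cnorm_small normr0.
exact: (@metric_structure.mdist_positivity R (opinion R) p q).
Qed.

Definition circle_net (n : nat) : seq (opinion R) :=
  [seq modS (-1 + i%:R / n.+1%:R) | i <- iota 0 (2 * n.+1).+1].

Lemma circle_netP n s : has (fun p => circle_dist p s < n.+1%:R^-1) (circle_net n).
Proof.
have n0 : 0 < n.+1%:R :> R by rewrite ltr0n.
have /andP[r0 r1] := rep_itv s.
have rn0 : 0 <= (rep s + 1) * n.+1%:R by rewrite mulr_ge0 ?(ltW n0)//; lra.
(* [i] numbers the grid point at or below [rep s]; [rep s <= 1] keeps it in range. *)
have /andP[i0 i1] := truncn_itv rn0; set i := Num.truncn _ in i0 i1.
apply/hasP; exists (modS (-1 + i%:R / n.+1%:R)).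
  apply/mapP; exists i => //; rewrite mem_iota/= add0n ltnS -(ler_nat R) (le_trans i0)//.
  by rewrite natrM ler_wpM2r ?(ltW n0)//; lra.
rewrite circle_distC circle_distE -[X in rep X - _](modSK s) cnorm_modSB.
rewrite (le_lt_trans (cnorm_le _))//.
have -> : rep s - (-1 + i%:R / n.+1%:R) = ((rep s + 1) * n.+1%:R - i%:R) / n.+1%:R.
  by field; rewrite gt_eqF.
rewrite normrM normfV (gtr0_norm n0) ger0_norm ?subr_ge0// ltr_pdivrMr// mulVf ?gt_eqF//.
by move: i1; rewrite -[i.+1%:R]natr1 ltrBlDl addrC.
Qed.

Lemma quantize_cvg (s : opinion R) :
  (fun n => quantize (circle_net n) n.+1%:R^-1 s) @ \oo --> s.
Proof.
apply/cvg_ballP => e e0.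
have := near_infty_natSinv_lt (PosNum e0).
apply: filterS => n ne; rewrite circle_ball circle_distC.
by rewrite (lt_trans _ ne)//; apply: quantize_close; exact: circle_netP.
Qed.

Notation prob := (probability (borel (config R)) R).

(** The level sets of [quantize l r] partition the circle; [undup] makes each value count once, and
    [point] covers the default value. *)
Lemma quantized_mixture (rho : probability (borel (opinion R)) R) l r (A : set (borel (config R))) :
  measurable A ->
  (rho ((@consensus R \o quantize l r) @^-1` A) =
   \sum_(p <- undup (point :: l))
     (fine (rho (quantize l r @^-1` [set p])))%:E * consensus_dirac p A)%E.
Proof.
move=> mA; pose q := quantize l r : borel (opinion R) -> borel (opinion R).
have mD p : measurable (q @^-1` [set p]).
  (* A singleton is the zero set of the distance to its point, which gives measurability from that
     of the distance. *)
  have -> : q @^-1` [set p] = (fun s : borel (opinion R) => circle_dist p (q s)) @^-1` [set 0].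
    by apply/seteqP; split=> s /=; rewrite circle_dist_eq0.
  rewrite -[X in measurable X]setTI.
  apply: (measurableT_comp (measurable_circle_dist p) (measurable_quantize l r)) => //.
have mqA : measurable ((@consensus R \o quantize l r) @^-1` A : set (borel (opinion R))).
  rewrite -[X in measurable X]setTI.
  exact: (measurableT_comp measurable_consensus (measurable_quantize l r)).
transitivity (\int[rho]_s (\1_((@consensus R \o quantize l r) @^-1` A) s)%:E)%E.
  by rewrite integral_indic// setIT.
transitivity (\int[rho]_s (\sum_(p <- undup (point :: l))
    (\1_(q @^-1` [set p]) s)%:E * consensus_dirac p A))%E.
  apply: eq_integral => s _; have qs := quantize_mem l r s.
  rewrite (bigD1_seq (q s)) ?mem_undup ?undup_uniq//= big1 => [|p pq].
    by rewrite adde0 [in RHS]indicE (mem_set (erefl (q s) : (q @^-1` [set q s]) s)) mul1e.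
  by rewrite indicE memNset ?mul0e// => /= qp; move: pq; rewrite -qp eqxx.
rewrite ge0_integral_sum//; last 2 first.
- move=> p; apply: emeasurable_funM; last exact: measurable_cst.
  by apply/measurable_EFinP; exact: measurable_indic.
- by move=> p s _; rewrite mule_ge0.
apply: eq_bigr => p _; rewrite ge0_integralZr//; last first.
  by apply/measurable_EFinP; exact: measurable_indic.
by rewrite integral_indic// setIT fineK// fin_num_measure.
Qed.

End quantization.

Section closed_hull.
Context {R : realType}.
Notation prob := (probability (borel (config R)) R).

(** Rounding the common opinion to finer and finer nets gives finite mixtures, which lie in [C] by
    convexity. They converge weakly to [nu] by dominated convergence, and [C] is closed. *)
Lemma mixture_in_closed_convex (C : set prob) (rho : probability (borel (opinion R)) R)
    (nu : prob) :
  range (@consensus_dirac R) `<=` C -> convex_measures C ->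
  closed (C : set (weak_prob (config R))) -> consensus_mixture rho nu -> C nu.
Proof.
move=> CD Cc Ccl mix.
pose q n : borel (opinion R) -> borel (config R) :=
  @consensus R \o quantize (circle_net n) n.+1%:R^-1.
have mq n : measurable_fun setT (q n).
  exact: (measurableT_comp measurable_consensus (measurable_quantize _ _)).
pose X n : {mfun borel (opinion R) >-> borel (config R)} := mfun_Sub (mem_set (mq n)).
pose m n : prob := distribution rho (X n).
have Cm n : C (m n).
  pose L := undup (point :: circle_net n : seq (opinion R)).
  pose p (o : opinion R) := fine (rho (quantize (circle_net n) n.+1%:R^-1 @^-1` [set o])).
  have mE A : measurable A -> m n A = (\sum_(o <- L) (p o)%:E * consensus_dirac o A)%E.
    by move=> mA; rewrite -(quantized_mixture rho (circle_net n) n.+1%:R^-1 mA).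
  have s1 : \sum_(a <- [seq (p o, o) | o <- L]) a.1 = 1.
    apply: EFin_inj; rewrite big_map/= -sumEFin -(probability_setT (m n)) mE//.
    apply: eq_bigr => o _; rewrite [consensus_dirac o setT]probability_setT.
    by rewrite mule1.
  have [|m' Cm' m'E] := finite_mixture Cc CD _ s1.
    by apply/allP => a /mapP[z _ ->] /=; rewrite /p fine_ge0.
  by apply: (convex_measures_ext Cc Cm') => A mA; rewrite mE// m'E// big_map.
suff mnu : (m : nat -> weak_prob (config R)) @ \oo --> (nu : weak_prob (config R)).
  apply: (@closed_cvg nat (weak_prob (config R)) \oo _ m C Ccl _ nu mnu).
  exact: nearW.
apply: initial_cvg; apply: ptws_cvg => -[f [cf bf]] /=; have [M [_ fM]] : bounded_fun f by exact: bf.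
have mf : measurable_fun setT (f : borel (config R) -> R).
  exact: (@borel_measurable_realfun R (config R) f cf).
have fb x : `|f x| <= M + 1 by apply: fM => //; rewrite ltrDl.
have nuE : (\int[nu]_x (f x)%:E = \int[rho]_s (f (consensus s))%:E)%E.
  pose Y : {mfun borel (opinion R) >-> borel (config R)} := mfun_Sub (mem_set measurable_consensus).
  transitivity (\int[distribution rho Y]_x (f x)%:E)%E.
    apply: eq_measure_integral => A mA _.
    by apply: etrans (mix A mA) _; exact: consensus_dirac_integral.
  rewrite integral_distribution//; first exact/measurable_EFinP.
  apply: (@integrable_bounded _ _ _ rho (f \o @consensus R) (M + 1)) => //.
    exact: (measurableT_comp mf measurable_consensus).
  by move=> s; exact: fb.
have mE n : (\int[m n]_x (f x)%:E = \int[rho]_s (f (q n s))%:E)%E.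
  rewrite /m integral_distribution//; first exact/measurable_EFinP.
  apply: (@integrable_bounded _ _ _ rho (f \o q n) (M + 1)) => //.
    exact: (measurableT_comp mf (mq n)).
  by move=> s; exact: fb.
suff : (fun n => fine (\int[m n]_x (f x)%:E)) @ \oo --> fine (\int[nu]_x (f x)%:E).
  by [].
apply: fine_cvg.
rewrite fineK; last first.
  apply: integrable_fin_num => //.
  exact: (@integrable_bounded _ _ _ nu f (M + 1)).
rewrite nuE; under eq_fun do rewrite mE.
apply: (@dominated_cvg _ _ _ rho setT measurableT _ _ (EFin \o cst (M + 1))) => //.
- move=> n; apply/measurable_EFinP; exact: (measurableT_comp mf (mq n)).
- move=> s _; apply: cvg_EFin; first exact: nearW.
  apply: (@continuous_cvg _ _ _ _ _ _ (f \o @consensus R)).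
    by apply: continuous_comp; [exact: consensus_continuous|exact: cf].
  exact: quantize_cvg.
- exact: finite_measure_integrable_cst.
- by move=> n x _ /=; rewrite lee_fin; exact: fb.
Qed.

(** The integrals are those of bounded continuous functions, so in this form the condition is
    visibly weakly closed. *)
Lemma gap_integral0P (nu : prob) :
  {ae nu, forall x : config R, forall e, gap e x = 0} <->
  forall e, \int[nu]_x gap e x = 0.
Proof.
split=> [nu0 e|nu0].
  apply: Rintegral_ae_cst; first exact: measurable_gap.
  by apply: ae_imp nu0 => x.
apply: ae_forall_countable => e.
have c0 : nu.-integrable setT (EFin \o cst (0 : R)) by exact: finite_measure_integrable_cst.
have := ae_eq_Rintegral_le c0 (integrable_gap nu e) (gap_ge0 e).
rewrite nu0 Rintegral_cstT lexx => /(_ isT).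
by apply: ae_imp => x /= <-.
Qed.

Lemma gap_bounded_continuous e :
  continuous (gap e : config R -> R) /\ bounded_fun (gap e : config R -> R).
Proof.
split; first exact: gap_continuous.
exists 1; split; first exact: num_real.
move=> r r1 x _; apply: le_trans (ltW r1).
by rewrite ger0_norm ?gap_ge0 ?gap_le1.
Qed.

Lemma closed_gap0 :
  closed ([set nu : prob | {ae nu, forall x : config R, forall e, gap e x = 0}]
    : set (weak_prob (config R))).
Proof.
pose g e : bounded_continuous (config R) := exist _ _ (gap_bounded_continuous e).
pose I (e : int) (nu : weak_prob (config R)) : R := \int[nu]_x sval (g e) x.
have cI e : continuous (I e).
  pose F (m : prob) : {ptws bounded_continuous (config R) -> R} :=
    fun f => \int[m]_x sval f x.
  move=> nu; apply: (@continuous_comp (weak_prob (config R))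
    {ptws bounded_continuous (config R) -> R} R F (fun h => h (g e))).
    exact: (@initial_continuous _ {ptws bounded_continuous (config R) -> R} F).
  exact: ptws_eval_continuous.
rewrite (_ : [set _ | _] = \bigcap_e (I e @^-1` [set 0])); last first.
  apply/seteqP; split=> nu /= => [/gap_integral0P nu0 e _|nu0]; first exact: nu0.
  by apply/gap_integral0P => e; exact: nu0.
apply: closed_bigI => e _; apply: preimage_closed; last exact: closed_eq.
by move=> nu _; exact: cI.
Qed.

(** The measures with zero gaps form one of the closed convex sets being intersected; conversely
    they are mixtures, which lie in every such set. *)
Lemma closed_convex_hull_diracs :
  closed_convex_hull (range (@consensus_dirac R)) =
  [set nu : prob | {ae nu, forall x : config R, forall e, gap e x = 0}].
Proof.
apply/seteqP; split=> [nu|nu nu0 C [CD Cc Ccl]]; last first.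
  have [rho mix] := ae_gap0_mixture nu0.
  exact: mixture_in_closed_convex mix.
apply; split; last exact: closed_gap0.
  move=> _ [s _ <-]; apply/ae_gap0P => e.
  by rewrite /consensus_dirac/= diracE memNset//= gap_consensus eqxx.
move=> m0 m1 m w /ae_gap0P m00 /ae_gap0P m10 _ mE; apply/ae_gap0P => e.
rewrite mE; last exact: measurable_gap_neq0.
by rewrite m00 m10 !mule0 adde0.
Qed.

End closed_hull.

Theorem theorem1p2 (R : realType) (mu : R) (mu_itv : 0 < mu <= 1 / 2)
  (d : measure_display) (Omega : measurableType d) (P : probability Omega R)
  (tau : int -> nat -> {RV P >-> R}) (xi : int -> nat -> {RV P >-> bool})
  (eta : R -> {mfun (borel (config R) * Omega)%type >-> borel (config R)})
  (noise : graphical_noise tau xi)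
  (flow : compass_flow tau xi mu eta) :
  (forall nu : probability (borel (config R)) R,
     invariant_measure P eta nu <->
     exists rho : probability (borel (opinion R)) R, consensus_mixture rho nu) /\
  [set nu | invariant_measure P eta nu] = closed_convex_hull (range (@consensus_dirac R)).
Proof.
split=> [nu|].
  split=> [nu_inv|[rho mix]].
    exact: ae_gap0_mixture (stationary_gap0 mu_itv noise flow nu_inv).
  exact: (ae_gap0_invariant noise flow (mixture_ae_gap0 mix)).
rewrite closed_convex_hull_diracs; apply/seteqP; split=> nu /=.
  exact: (stationary_gap0 mu_itv noise flow).
exact: (ae_gap0_invariant noise flow).
Qed.
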